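(* For all integers $j \geq 0$ and all integers $n \geq 0$, the following six congruences hold: \begin{align*} \overline{spt2}(2^{j+4}\cdot n+7\cdot 2^{j+1}) & \equiv 0 \pmod{4},\\ \overline{spt2}(2^{j+2}\cdot 9n+15\cdot 2^{j+1}) & \equiv 0 \pmod{4},\\ \overline{spt2}(2^{j+4}\cdot 3n+17\cdot 2^{j+1}) & \equiv 0 \pmod{4},\\ \overline{spt2}(2^{j+3}\cdot 9n+21\cdot 2^{j+1}) & \equiv 0 \pmod{4},\\ \overline{spt2}(2^{j+4}\cdot 5n+17\cdot 2^{j+1}) & \equiv 0 \pmod{4},\\ \overline{spt2}(2^{j+4}\cdot 5n+33\cdot 2^{j+1}) & \equiv 0 \pmod{4}. \end{align*}
   Context: An overpartition of a positive integer $n$ is a partition of $n$ (a non-increasing sequence of positive integers with sum $n$) in which the first occurrence of each distinct part may or may not be overlined. The function $\overline{spt2}(n)$ is the total number of smallest parts in the overpartitions of $n$ whose smallest part is even and is not overlined. That is, $\overline{spt2}(n)$ is the sum, over all overpartitions of $n$ whose smallest part is even and has no overlined occurrence, of the number of times the smallest part occurs. For example, $\overline{spt2}(4)=3$: among the 14 overpartitions of $4$, the ones that contribute are $4$ (contributing 1) and $2+2$ (contributing 2). *)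

(* Defs.v *)
From mathcomp Require Import all_boot.

Set Implicit Arguments.
Unset Strict Implicit.
Unset Printing Implicit Defensive.

(* A list of parts, each carrying a flag that is [true] when it is overlined. *)
Definition oparts (p : seq (nat * bool)) : seq nat := unzip1 p.

Definition only_first_overlined (p : seq (nat * bool)) : bool :=
  all (fun i => nth false (unzip2 p) i ==>
                (nth 0 (oparts p) i \notin take i (oparts p)))
      (iota 0 (size p)).

Definition is_overpartition (n : nat) (p : seq (nat * bool)) : bool :=
  [&& all (leq 1) (oparts p),
      sorted geq (oparts p),
      sumn (oparts p) == n
    & only_first_overlined p].

(* Parts are listed in non-increasing order, so the smallest one is the last. *)
Definition smallest_part (p : seq (nat * bool)) : nat := last 0 (oparts p).

Definition smallest_even_not_overlined (p : seq (nat * bool)) : bool :=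
  ~~ odd (smallest_part p) && ((smallest_part p, true) \notin p).

Definition num_smallest_part (p : seq (nat * bool)) : nat :=
  count_mem (smallest_part p) (oparts p).

(* An overpartition of n has at most n parts, each at most n, so it is the
   decoding of exactly one code in this finite type. *)
Definition ocode (n : nat) := {bseq n of 'I_n.+1 * bool}.

Definition odecode (n : nat) (c : ocode n) : seq (nat * bool) :=
  [seq (val x.1, x.2) | x <- c].

Definition spt2bar (n : nat) : nat :=
  \sum_(c : ocode n | is_overpartition n (odecode c) &&
                      smallest_even_not_overlined (odecode c))
    num_smallest_part (odecode c).

(* Main.v *)
(* Let sigma be the sum of divisors. Grouping overpartitions by their run of smallest parts and
   noting that every larger distinct part doubles the number of overlinings, only overpartitions
   with at most two distinct parts matter modulo 4:
     spt2bar(2N) = sigma(N) + 2 C(N) mod 4,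
   where C(N) counts the positive solutions of k b + 2 m a = 2N with a odd and k > 2m.
   The parity of C(N) is computed by involutions and bijections of the type
   k b + m a = (k - m) b + m (a + b). They show that, for M odd and not a square, C(2^j M) has the
   parity of the number F(M) of representations of M by 2 y^2 + x^2 with x, y > 0, so that
     spt2bar(2^(j+1) M) = sigma(M) + 2 F(M) mod 4.
   - If M = 7 mod 8, then F(M) = 0 and 4 divides sigma(M).
   - If M = 3K with K prime to 3, then sigma(M) = 4 sigma(K), and the two primes of Z[sqrt(-2)]
     above 3 give a fixed-point-free involution on the representations of M.
   - If M = 1 mod 8, then both sigma(M)/2 and F(M) have the parity of the number of divisors
     d of M with d^2 < M. For F(M), swapping arguments reduce representations by x^2 + 8 y^2 to
     representations by x^2 + 16 y^2 plus solutions of x^2 + 8 k b = M with b odd. The latter are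
     even in number by the logarithmic derivative modulo 2 of Gauss's product for
     sum_t q^(t(t+1)/2), and the former are counted by Zagier's involution on x^2 + 4 y z = M. *)

Require Import Defs.
From mathcomp Require Import all_boot all_algebra.
From mathcomp Require Import zify ring.

Set Implicit Arguments.
Unset Strict Implicit.
Unset Printing Implicit Defensive.

(** * Counting solutions of [u k b + v m a = N] *)

Lemma count_bij (T1 T2 : eqType) (s1 : seq T1) (s2 : seq T2)
    (P1 : pred T1) (P2 : pred T2) (f : T1 -> T2) (g : T2 -> T1) :
    uniq s1 -> uniq s2 ->
    (forall x, x \in s1 -> P1 x -> [/\ f x \in s2, P2 (f x) & g (f x) = x]) ->
    (forall y, y \in s2 -> P2 y -> [/\ g y \in s1, P1 (g y) & f (g y) = y]) ->
  count P1 s1 = count P2 s2.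
Proof.
move=> u1 u2 fP gP; rewrite -!size_filter -(size_map f).
apply/perm_size/uniq_perm.
- rewrite map_inj_in_uniq ?filter_uniq // => x y.
  rewrite !mem_filter => /andP[Px xs] /andP[Py ys] efxy.
  by have [_ _ <-] := fP x xs Px; have [_ _ <-] := fP y ys Py; rewrite efxy.
- exact: filter_uniq.
move=> y; rewrite mem_filter; apply/mapP/andP => [[x]|[Py ys]].
  by rewrite mem_filter => /andP[Px xs] ->; have [] := fP x xs Px.
have [gs Pg fgy] := gP y ys Py.
by exists (g y); rewrite ?mem_filter ?Pg ?gs ?fgy.
Qed.

(** Points moved by [f] cancel in pairs: the induction removes [x] and [f x] together. *)
Lemma odd_count_invol (T : eqType) (s : seq T) (P : pred T) (f : T -> T) :
    uniq s ->
    (forall x, x \in s -> P x -> [/\ f x \in s, P (f x) & f (f x) = x]) ->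
  odd (count P s) = odd (count (fun x => P x && (f x == x)) s).
Proof.
move=> us fP.
have [n] := ubnP (size s).
elim: n s us fP => // n IHn [|x s] //= /andP[xs us] fP size_lt.
case Px: (P x) => /=; last first.
  rewrite add0n; apply: IHn => //.
  move=> y ys Py; have [] := fP y _ Py; first by rewrite inE ys orbT.
  rewrite inE => /predU1P[-> Pfx|fys Pfy ffy //]; by rewrite Pfx in Px.
have [fxs Pfx ffx] := fP x (mem_head _ _) Px.
have [fx_x|fx_x] := eqVneq (f x) x.
  congr (~~ _); apply: IHn => // y ys Py.
  have [|fys Pfy ffy] := fP y _ Py; first by rewrite inE ys orbT.
  split => //; move: fys; rewrite inE => /predU1P[fyx|//].
  by move: xs; rewrite -fx_x -fyx ffy ys.
rewrite inE (negPf fx_x) /= in fxs.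
have perm_s : perm_eq s (f x :: rem (f x) s) by exact: perm_to_rem.
rewrite !(permP perm_s) /= Pfx ffx eq_sym (negPf fx_x) /= !add0n negbK.
have us' : uniq (rem (f x) s) by exact: rem_uniq.
apply: IHn => // [y|].
  rewrite !mem_rem_uniq // !inE => /andP[yfx ys] Py.
  have [|] := fP y _ Py; first by rewrite inE ys orbT.
  rewrite inE => /predU1P[fyx _|fys Pfy ffy].
    by rewrite fyx => fxy; rewrite -fxy eqxx in yfx.
  split => //; rewrite fys andbT; apply: contraNneq xs => fyfx.
  by rewrite -ffx -fyfx ffy.
by rewrite (perm_size perm_s) /= in size_lt; apply: ltnW.
Qed.

Lemma mem_allpairs_pair (S T : eqType) (s : seq S) (t : seq T) x y :
  ((x, y) \in [seq (x, y) | x <- s, y <- t]) = (x \in s) && (y \in t).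
Proof.
by apply/allpairsP/andP => [[p [ps pt [-> ->]]]|[xs yt]] //; exists (x, y).
Qed.

Definition quad := (nat * nat * nat * nat)%type.

(** For positive [u] and [v] every entry of a solution is at most [N] ([sol_box]), so this finite
    box misses none. *)
Definition box (N : nat) : seq quad :=
  [seq (x, y) | x <- [seq (x, y) | x <- [seq (x, y) | x <- iota 0 N.+1, y <- iota 0 N.+1],
                                   y <- iota 0 N.+1],
                y <- iota 0 N.+1].

Lemma box_uniq N : uniq (box N).
Proof.
by rewrite !allpairs_uniq ?iota_uniq // => -[? ?] [? ?] _ _ [-> ->].
Qed.

Lemma mem_box N k b m a :
  ((k, b, m, a) \in box N) = [&& k <= N, b <= N, m <= N & a <= N].
Proof. by rewrite !mem_allpairs_pair !mem_iota !ltnS -!andbA. Qed.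

Definition sol (u v N : nat) (q : quad) : bool :=
  let: (k, b, m, a) := q in
  [&& 0 < k, 0 < b, 0 < m, 0 < a & u * (k * b) + v * (m * a) == N].

Definition qpred := nat -> nat -> nat -> nat -> bool.

(* Locked, since otherwise rewriting with [oddD] unfolds the count. *)
Definition nsol (u v N : nat) (P : qpred) : nat := locked
  (count (fun q : quad => let: (k, b, m, a) := q in sol u v N (k, b, m, a) && P k b m a) (box N)).

Lemma sol_box u v N q : 0 < u -> 0 < v -> sol u v N q -> q \in box N.
Proof.
case: q => [[[k b] m] a] u0 v0 /= /and5P[k0 b0 m0 a0 /eqP <-].
have le1 : k * b <= u * (k * b) by apply: leq_pmull.
have le2 : m * a <= v * (m * a) by apply: leq_pmull.
have le3 : k <= k * b by apply: leq_pmulr.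
have le4 : b <= k * b by apply: leq_pmull.
have le5 : m <= m * a by apply: leq_pmulr.
have le6 : a <= m * a by apply: leq_pmull.
by rewrite mem_box; lia.
Qed.

Lemma eq_nsol u v N (P Q : qpred) :
    (forall k b m a, sol u v N (k, b, m, a) -> P k b m a = Q k b m a) ->
  nsol u v N P = nsol u v N Q.
Proof.
move=> PQ; rewrite /nsol -!lock; apply: eq_count => -[[[k b] m] a].
by case s: (sol _ _ _ _) => //; rewrite PQ.
Qed.

Lemma nsol_split u v N (C P : qpred) :
  nsol u v N P = nsol u v N (fun k b m a => P k b m a && C k b m a)
               + nsol u v N (fun k b m a => P k b m a && ~~ C k b m a).
Proof.
rewrite /nsol -!lock -count_predUI.
set e := count (predI _ _) _; have -> : e = 0.
  by rewrite /e -(count_pred0 (box N)); apply: eq_count => -[[[k b] m] a] /=;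
     case: (C _ _ _ _); rewrite /= ?andbF.
rewrite addn0; apply: eq_count => -[[[k b] m] a] /=.
by rewrite -!andb_orr orbN andbT.
Qed.

Lemma nsol_bij u v N u' v' N' (P Q : qpred) (f g : quad -> quad) :
    0 < u -> 0 < v -> 0 < u' -> 0 < v' ->
    (forall k b m a, sol u v N (k, b, m, a) -> P k b m a ->
       let: (k', b', m', a') := f (k, b, m, a) in
       [/\ sol u' v' N' (k', b', m', a'), Q k' b' m' a' & g (k', b', m', a') = (k, b, m, a)]) ->
    (forall k b m a, sol u' v' N' (k, b, m, a) -> Q k b m a ->
       let: (k', b', m', a') := g (k, b, m, a) in
       [/\ sol u v N (k', b', m', a'), P k' b' m' a' & f (k', b', m', a') = (k, b, m, a)]) ->
  nsol u v N P = nsol u' v' N' Q.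
Proof.
move=> u0 v0 u0' v0' fP gP.
rewrite /nsol -!lock.
apply: (count_bij (f := f) (g := g)); rewrite ?box_uniq // => -[[[k b] m] a] _ /andP[s PQ].
  case: (f _) (fP _ _ _ _ s PQ) => [[[k' b'] m'] a'] [s' -> ->].
  by rewrite (sol_box _ _ s') // s'.
case: (g _) (gP _ _ _ _ s PQ) => [[[k' b'] m'] a'] [s' -> ->].
by rewrite (sol_box _ _ s') // s'.
Qed.

Lemma odd_nsol_invol u v N (P : qpred) (f : quad -> quad) :
    0 < u -> 0 < v ->
    (forall k b m a, sol u v N (k, b, m, a) -> P k b m a ->
       let: (k', b', m', a') := f (k, b, m, a) in
       [/\ sol u v N (k', b', m', a'), P k' b' m' a' & f (k', b', m', a') = (k, b, m, a)]) ->
  odd (nsol u v N P) =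
  odd (nsol u v N (fun k b m a => P k b m a && (f (k, b, m, a) == (k, b, m, a)))).
Proof.
move=> u0 v0 fP; rewrite /nsol -!lock (odd_count_invol (f := f)) ?box_uniq //.
  congr odd; apply: eq_count => -[[[k b] m] a].
  by rewrite andbA.
move=> -[[[k b] m] a] _ /andP[s Pq].
case: (f _) (fP _ _ _ _ s Pq) => [[[k' b'] m'] a'] [s' -> ->].
by rewrite (sol_box _ _ s') // s'.
Qed.

Lemma nsol0 u v N (P : qpred) :
  (forall k b m a, sol u v N (k, b, m, a) -> P k b m a -> False) -> nsol u v N P = 0.
Proof.
move=> no; rewrite /nsol -lock -(count_pred0 (box N)); apply: eq_count => -[[[k b] m] a].
by apply/negP => /andP[s /(no _ _ _ _ s)].
Qed.

(** * The parity of the number of cross terms *)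

(** [cross] is C(N): the smallest part [2 m] occurs [a] times, a larger part [k] occurs [b] times.
    As [k b] is even, either [b] is odd and [k] is halved ([cross_odd]), or [b] is halved
    ([cross_even]). *)
Definition cross N := nsol 1 2 N.*2 (fun k b m a => odd a && (m.*2 < k)).
Definition cross_odd N := nsol 1 1 N (fun k b m a => [&& odd a, odd b & m < k]).
Definition cross_even N := nsol 1 1 N (fun k b m a => odd a && (m.*2 < k)).

Lemma cross_split N : cross N = cross_odd N + cross_even N.
Proof.
rewrite /cross (nsol_split _ _ _ (fun _ b _ _ => odd b)); congr (_ + _).
  apply: (nsol_bij (f := fun '(k, b, m, a) => (k./2, b, m, a))
                   (g := fun '(k, b, m, a) => (k.*2, b, m, a))) => // k b m a /=.
    move=> /and5P[k0 b0 m0 a0 /eqP e] /andP[/andP[oa mk] ob].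
    have ek : k./2.*2 = k by have := odd_double_half k; nia.
    set h := k./2 in ek *; rewrite -ek in e mk *.
    split; [by apply/and5P; split; nia|by rewrite oa ob; lia|by []].
  move=> /and5P[k0 b0 m0 a0 /eqP e] /and3P[oa ob mk].
  rewrite doubleK; split; [by apply/and5P; split; nia|by rewrite oa ob; lia|by []].
apply: (nsol_bij (f := fun '(k, b, m, a) => (k, b./2, m, a))
                 (g := fun '(k, b, m, a) => (k, b.*2, m, a))) => // k b m a /=.
  move=> /and5P[k0 b0 m0 a0 /eqP e] /andP[/andP[oa mk] ob].
  have eb : b./2.*2 = b by have := odd_double_half b; lia.
  set h := b./2 in eb *; rewrite -eb in e b0 *.
  split; [by apply/and5P; split; nia|by rewrite oa; lia|by []].
move=> /and5P[k0 b0 m0 a0 /eqP e] /andP[oa mk].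
rewrite doubleK odd_double; split; [by apply/and5P; split; nia|by rewrite oa; lia|by []].
Qed.

(* The fixed points satisfy [2 * b * (a + b) = N]. *)
Lemma odd_cross_even_odd_k N :
  odd (nsol 1 1 N (fun k b m a => (odd a && (m.*2 < k)) && odd k)) =
  odd (nsol 1 1 N (fun k b m a => [&& odd a, k == a + b.*2 & m == b])).
Proof.
rewrite (odd_nsol_invol (f := fun '(k, b, m, a) => (a + b.*2, m, b, k - m.*2))) //.
  congr odd; apply: eq_nsol => k b m a /= _.
  rewrite !xpair_eqE; lia.
move=> k b m a /= /and5P[k0 b0 m0 a0 /eqP e] /andP[/andP[oa mk] ok].
have [c ek] : exists c, k = c + m.*2 by exists (k - m.*2); lia.
rewrite ek addnK in mk ok e *.
split; [by apply/and5P; split; nia|by lia|].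
by rewrite addnK.
Qed.

(** With [k] even and [a] odd, [m] is even too, so [k] and [m] are halved together. *)
Lemma cross_even_double N :
  nsol 1 1 N.*2 (fun k b m a => (odd a && (m.*2 < k)) && ~~ odd k) = cross_even N.
Proof.
apply: (nsol_bij (f := fun '(k, b, m, a) => (k./2, b, m./2, a))
                 (g := fun '(k, b, m, a) => (k.*2, b, m.*2, a))) => // k b m a /=.
  move=> /and5P[k0 b0 m0 a0 /eqP e] /andP[/andP[oa mk] ok].
  have ek : k./2.*2 = k by have := odd_double_half k; lia.
  have om : ~~ odd m.
    have: ~~ odd (m * a) by have := congr1 odd e; rewrite oddD !oddM odd_double; lia.
    by rewrite oddM oa andbT.
  have em : m./2.*2 = m by have := odd_double_half m; lia.
  set h := k./2 in ek *; set h' := m./2 in em *; rewrite -ek -em in k0 m0 e mk *.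
  split; [by apply/and5P; split; nia|by rewrite oa; lia|by []].
move=> /and5P[k0 b0 m0 a0 /eqP e] /andP[oa mk].
by rewrite !doubleK odd_double; split; [by apply/and5P; split; nia|by rewrite oa; lia|].
Qed.

Lemma cross_even_of_odd N : odd N ->
  nsol 1 1 N (fun k b m a => (odd a && (m.*2 < k)) && ~~ odd k) =
  nsol 2 1 N (fun k b m a => m < k).
Proof.
move=> oN.
apply: (nsol_bij (f := fun '(k, b, m, a) => (k./2, b, m, a))
                 (g := fun '(k, b, m, a) => (k.*2, b, m, a))) => // k b m a /=.
  move=> /and5P[k0 b0 m0 a0 /eqP e] /andP[/andP[oa mk] ok].
  have ek : k./2.*2 = k by have := odd_double_half k; lia.
  set h := k./2 in ek *; rewrite -ek in k0 e mk *.
  by split; [by apply/and5P; split; nia|lia|].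
move=> /and5P[k0 b0 m0 a0 /eqP e] mk.
have := congr1 odd e; rewrite oN oddD !oddM /= => /andP[_ oa].
by rewrite !doubleK odd_double oa; split; [by apply/and5P; split; nia|lia|].
Qed.

(** Halving an even [k] gives the solutions with [m < 2 k]. For odd [k = m + 2 c], the identity [2
    (m + 2 c) b + m a = 4 b c + (a + 2 b) m] gives those with [m > 2 k]. Equality cannot occur, as
    [m] is odd. *)
Lemma nsol2_lt N : odd N -> nsol 2 1 N (fun k b m a => m < k) = nsol 4 1 N (fun _ _ _ _ => true).
Proof.
move=> oN; rewrite (nsol_split _ _ _ (fun k _ _ _ => ~~ odd k)).
rewrite (nsol_split 4 _ _ (fun k _ m _ => m < k.*2)); congr (_ + _).
  apply: (nsol_bij (f := fun '(k, b, m, a) => (k./2, b, m, a))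
                   (g := fun '(k, b, m, a) => (k.*2, b, m, a))) => // k b m a /=.
    move=> /and5P[k0 b0 m0 a0 /eqP e] /andP[mk ok].
    have ek : k./2.*2 = k by have := odd_double_half k; lia.
    set h := k./2 in ek *; rewrite -ek in k0 e mk *.
    by split; [by apply/and5P; split; nia|lia|].
  move=> /and5P[k0 b0 m0 a0 /eqP e] mk.
  by rewrite !doubleK odd_double; split; [by apply/and5P; split; nia|lia|].
apply: (nsol_bij (f := fun '(k, b, m, a) => (b, (k - m)./2, a + b.*2, m))
                 (g := fun '(k, b, m, a) => (a + b.*2, k, a, m - k.*2))) => // k b m a /=.
  move=> /and5P[k0 b0 m0 a0 /eqP e] /andP[mk ok].
  have := congr1 odd e; rewrite oN oddD !oddM /= => /andP[om oa].
  have [c ek] : exists c, k = c.*2 + m.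
    by exists (k - m)./2; have := odd_double_half (k - m); rewrite oddB 1?ltnW // om; lia.
  rewrite ek !addnK doubleK in k0 e mk *.
  by split; [by apply/and5P; split; nia|lia|rewrite addnC].
move=> /and5P[k0 b0 m0 a0 /eqP e] /= mk.
have := congr1 odd e; rewrite oN oddD !oddM /= => /andP[om oa].
have mk' : k.*2 < m by lia.
have [c em] : exists c, m = c + k.*2 by exists (m - k.*2); lia.
rewrite em !addnK addKn doubleK in e mk' *.
by split; [by apply/and5P; split; nia|lia|].
Qed.

(** Exactly one of [k] and [m] is even. It is halved and its product put first; comparing [m] with
    [2 k] recovers which one it was. *)
Lemma cross_odd_of_odd N : odd N -> cross_odd N = nsol 2 1 N (fun k b m a => odd b).
Proof.
move=> oN.
apply: (nsol_bij (f := fun '(k, b, m, a) => if odd k then (m./2, a, k, b) else (k./2, b, m, a))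
                 (g := fun '(k, b, m, a) => if m < k.*2 then (k.*2, b, m, a) else (m, a, k.*2, b)))
  => // k b m a /=.
  move=> /and5P[k0 b0 m0 a0 /eqP e] /and3P[oa ob mk].
  have := congr1 odd e; rewrite oN oddD !oddM oa ob /= !andbT => okm.
  case ok : (odd k) okm => /= om.
    have em : m./2.*2 = m by have := odd_double_half m; lia.
    set h := m./2 in em *; rewrite -em in m0 e mk *.
    have -> : (k < h.*2) = false by lia.
    by split; [by apply/and5P; split; nia| |].
  have ek : k./2.*2 = k by have := odd_double_half k; lia.
  set h := k./2 in ek *; rewrite -ek in k0 e mk *.
  by rewrite mk; split; [by apply/and5P; split; nia| |].
move=> /and5P[k0 b0 m0 a0 /eqP e] ob.
have := congr1 odd e; rewrite oN oddD !oddM /= => /andP[om oa].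
case: ltnP => mk; rewrite ?odd_double ?om doubleK.
  by split; [by apply/and5P; split; nia|rewrite oa ob|].
split; [by apply/and5P; split; nia| rewrite oa ob /=|by []].
have: m != k.*2 by apply: contraTneq om => ->; rewrite odd_double.
by lia.
Qed.

Lemma nsol2_even_b N :
  nsol 2 1 N (fun k b m a => ~~ odd b) = nsol 4 1 N (fun _ _ _ _ => true).
Proof.
apply: (nsol_bij (f := fun '(k, b, m, a) => (k, b./2, m, a))
                 (g := fun '(k, b, m, a) => (k, b.*2, m, a))) => // k b m a /=.
  move=> /and5P[k0 b0 m0 a0 /eqP e] ob.
  have eb : b./2.*2 = b by have := odd_double_half b; lia.
  set h := b./2 in eb *; rewrite -eb in e b0 *.
  by split; [by apply/and5P; split; nia| |].
by rewrite doubleK odd_double => /and5P[k0 b0 m0 a0 /eqP e] _; split; [by apply/and5P; split; nia| |].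
Qed.

(** Swapping [k] with [b] cancels the other solutions in pairs; the next lemma swaps [m] with [a] at
    the same time. *)
Lemma odd_nsol_square u v N : 0 < u -> 0 < v ->
  odd (nsol u v N (fun _ _ m a => m == a)) =
  odd (nsol u v N (fun k b m a => (k == b) && (m == a))).
Proof.
move=> u0 v0; rewrite (odd_nsol_invol (f := fun '(k, b, m, a) => (b, k, m, a))) //=.
  by congr odd; apply: eq_nsol => k b m a _; rewrite !xpair_eqE; lia.
by move=> k b m a /and5P[k0 b0 m0 a0 /eqP <-] ma; rewrite k0 b0 m0 a0 [b * k]mulnC eqxx.
Qed.

Lemma odd_nsol_squares u v N : 0 < u -> 0 < v ->
  odd (nsol u v N (fun _ _ _ _ => true)) =
  odd (nsol u v N (fun k b m a => (k == b) && (m == a))).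
Proof.
move=> u0 v0; rewrite (odd_nsol_invol (f := fun '(k, b, m, a) => (b, k, a, m))) //=.
  by congr odd; apply: eq_nsol => k b m a _; rewrite !xpair_eqE; lia.
move=> k b m a /and5P[k0 b0 m0 a0 /eqP <-] _.
by rewrite k0 b0 m0 a0 [b * k]mulnC [a * m]mulnC eqxx.
Qed.

(** The number of representations of [N] by [u y^2 + x^2] with [x, y > 0]; [u = 2] gives F(N). *)
Definition nsquares u N := nsol u 1 N (fun k b m a => (k == b) && (m == a)).

(** In [cross_even], odd [k] contributes an even number. What remains, together with [cross_odd],
    counts all solutions of [2 k b + m a = N], split by the parity of [b]; swapping then leaves the
    squares. *)
Lemma odd_cross_of_odd N : odd N -> odd (cross N) = odd (nsquares 2 N).
Proof.
move=> oN; rewrite cross_split oddD /cross_even (nsol_split _ _ _ (fun k _ _ _ => odd k)) oddD odd_cross_even_odd_k.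
(* A fixed point would make [N = 2 b (a + b)] even. *)
rewrite nsol0 => [|k b m a /= /and5P[_ _ _ _ /eqP e] /and3P[oa /eqP ek /eqP em]]; last first.
  by have := congr1 odd e; rewrite oN ek em oddD !oddM oddD odd_double oa; lia.
rewrite cross_even_of_odd // nsol2_lt // -nsol2_even_b cross_odd_of_odd // /= -oddD.
rewrite -(nsol_split _ _ _ (fun _ b _ _ => odd b) (fun _ _ _ _ => true)).
exact: odd_nsol_squares.
Qed.

(** * Doubling [N] preserves the parity *)

Lemma cross_odd_double N :
  cross_odd N.*2 = nsol 1 1 N.*2 (fun k b m a => [&& odd a, odd b, odd k & m < k]) + cross_odd N.
Proof.
rewrite {1}/cross_odd (nsol_split _ _ _ (fun k _ _ _ => odd k)); congr (_ + _).
  by apply: eq_nsol => k b m a _; lia.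
apply: (nsol_bij (f := fun '(k, b, m, a) => (k./2, b, m./2, a))
                 (g := fun '(k, b, m, a) => (k.*2, b, m.*2, a))) => // k b m a /=.
  move=> /and5P[k0 b0 m0 a0 /eqP e] /andP[/and3P[oa ob mk] ok].
  have := congr1 odd e; rewrite odd_double oddD !oddM oa ob (negPf ok) !andbT /= => om.
  have ek : k./2.*2 = k by have := odd_double_half k; lia.
  have em : m./2.*2 = m by have := odd_double_half m; lia.
  set h := k./2 in ek *; set h' := m./2 in em *; rewrite -ek -em in k0 m0 e mk *.
  by split; [by apply/and5P; split; nia|lia|].
move=> /and5P[k0 b0 m0 a0 /eqP e] /and3P[oa ob mk].
by rewrite oa ob !doubleK odd_double; split; [by apply/and5P; split; nia|lia|].
Qed.

(** The terms come from [a < b], [a = b] and [a > b]. The involution swaps the factors inside both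
    products in the first case and exchanges [k b] with [a m] in the last. *)
Lemma odd_nsol_all_odd N :
  odd (nsol 1 1 N.*2 (fun k b m a => [&& odd a, odd b, odd k & m < k])) =
  odd (nsol 1 1 N.*2 (fun k b m a => [&& odd a, odd k, m < k, k == b & m == a])
     + nsol 1 1 N.*2 (fun k b m a => [&& odd a, odd k, m < k & a == b])
     + nsol 1 1 N.*2 (fun k b m a => [&& odd b, odd k, b < k, k == a & m == b])).
Proof.
rewrite (nsol_split _ _ _ (fun _ b _ a => a < b)) !oddD.
rewrite [X in _ (+) odd X](nsol_split _ _ _ (fun _ b _ a => a == b)) oddD addbA.
congr (_ (+) _ (+) _).
- rewrite (odd_nsol_invol (f := fun '(k, b, m, a) => (b, k, a, m))) //.
    by congr odd; apply: eq_nsol => k b m a _; rewrite !xpair_eqE; lia.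
  by move=> k b m a /= /and5P[k0 b0 m0 a0 /eqP e] H;
    split; [by apply/and5P; split; nia|lia|].
- by congr odd; apply: eq_nsol => k b m a _; lia.
rewrite (odd_nsol_invol (f := fun '(k, b, m, a) => (a, m, b, k))) //.
  by congr odd; apply: eq_nsol => k b m a _; rewrite !xpair_eqE; lia.
move=> k b m a /= /and5P[k0 b0 m0 a0 /eqP e] H.
have om : odd m.
  by have := congr1 odd e; rewrite odd_double oddD !oddM; lia.
by split; [by apply/and5P; split; nia|lia|].
Qed.

Definition halfdiv M := count (fun d => d * d < M) (divisors M).

Definition nonsquare M := forall x, x * x <> M.

Lemma nonsquare_gt0 M : nonsquare M -> 0 < M.
Proof. by case: M => // /(_ 0). Qed.

Lemma divisors_invol M d : 0 < M -> d \in divisors M ->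
  M %/ d \in divisors M /\ M %/ (M %/ d) = d.
Proof.
move=> M0; rewrite -!dvdn_divisors // => dM.
by rewrite dvdn_div // divnA // mulKn.
Qed.

Lemma size_divisors M : nonsquare M -> size (divisors M) = (halfdiv M).*2.
Proof.
move=> nsM; have M0 := nonsquare_gt0 nsM.
rewrite -(count_predC (fun d => d * d < M) (divisors M)) -addnn; congr (_ + _).
apply: (count_bij (f := divn M) (g := divn M)); rewrite ?divisors_uniq // => d dM.
  have [eM eK] := divisors_invol M0 dM; rewrite /= -leqNgt => le; split=> //.
  move: dM; rewrite -dvdn_divisors // => /dvdnP[e eq].
  have := nsM d; rewrite eq mulnK; nia.
have [eM eK] := divisors_invol M0 dM => lt; split=> //=.
move: dM; rewrite -dvdn_divisors // => /dvdnP[e eq].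
rewrite -leqNgt eq mulnK; nia.
Qed.

Lemma odd_dvdn_pow2M d j M : odd d -> d %| 2 ^ j * M -> d %| M.
Proof. by move=> od; rewrite Gauss_dvdr // coprimeXr // coprimen2. Qed.

(** The equation is [b (a + b) = 2^(j+1) M]. As [a] is odd, exactly one factor is odd, and it is a
    divisor [d] of [M]. Conversely, [b] is the smaller of [d] and [2^(j+1) M / d]. *)
Lemma cross_even_fixed_count j M : odd M ->
  nsol 1 1 (2 ^ j.+1 * M).*2 (fun k b m a => [&& odd a, k == a + b.*2 & m == b]) =
  size (divisors M).
Proof.
move=> oM; have M0 := odd_gt0 oM.
rewrite -(count_predT (divisors M)) /nsol -lock.
have dvdM d := @odd_dvdn_pow2M d j.+1 M; move: dvdM.
have : 0 < 2 ^ j.+1 by rewrite expn_gt0.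
have : ~~ odd (2 ^ j.+1) by rewrite oddX.
move: (2 ^ j.+1) => p even_p p0 dvdM.
apply: (count_bij (f := fun '(k, b, m, a) => if odd b then b else a + b)
          (g := fun d => let e := p * (M %/ d) in
                if d < e then (e + d, d, d, e - d) else (d + e, e, e, d - e)));
  rewrite ?box_uniq ?divisors_uniq //.
  move=> -[[[k b] m] a] _ /andP[/and5P[k0 b0 m0 a0 /eqP e] /and3P[oa /eqP ek /eqP em]].
  have e' : b * (a + b) = p * M by move: e; rewrite ek em; nia.
  rewrite -dvdn_divisors //; case: ifP => ob.
    have /dvdnP[c eM] : b %| M by apply: dvdM => //; rewrite -e' dvdn_mulr.
    have eab : a + b = p * c.
      by apply/eqP; rewrite -(eqn_pmul2l b0) e' eM mulnA [b * _]mulnC.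
    rewrite {1 2}eM dvdn_mull // mulnK // -eab.
    rewrite /=; have -> : b < a + b by lia.
    by rewrite ek em addnK; split => //; rewrite -addnn addnA.
  have od : odd (a + b) by rewrite oddD oa ob.
  have /dvdnP[c eM] : a + b %| M.
    by apply: dvdM => //; rewrite -e' dvdn_mull.
  have d0 : 0 < a + b by rewrite addn_gt0 a0.
  have eb : b = p * c by apply/eqP; rewrite -(eqn_pmul2r d0) e' -mulnA -eM.
  rewrite {1 2}eM dvdn_mull // mulnK // -eb.
  rewrite /=; have -> : (a + b < b) = false by lia.
  by rewrite ek em addnK; split => //; rewrite -addnn addnA.
move=> d; rewrite -dvdn_divisors // => /dvdnP[c eM] _ /=.
have d0 : 0 < d by case: d eM => // eM; rewrite eM muln0 in M0.
have c0 : 0 < c by case: c eM => // eM; rewrite eM in M0.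
rewrite eM mulnK //.
have od : odd d by rewrite eM oddM in oM; case/andP: oM.
set e := p * c.
have oe : ~~ odd e by rewrite /e oddM (negPf even_p).
have e0 : 0 < e by rewrite /e muln_gt0 p0.
have ede : p * (c * d) = e * d by rewrite mulnA.
move: e oe e0 ede => e oe e0 ede.
have mbox q : sol 1 1 (p * (c * d)).*2 q -> q \in box (p * (c * d)).*2 by apply: sol_box.
case: ltnP => le.
  have [f ef] : exists f, e = f + d by exists (e - d); lia.
  have s : sol 1 1 (p * (c * d)).*2 (e + d, d, d, e - d).
    by rewrite ede; apply/and5P; split; nia.
  by split; [exact: mbox|apply/andP; split; [exact: s|lia]|rewrite od].
have [f ef] : exists f, d = f + e by exists (d - e); lia.
have s : sol 1 1 (p * (c * d)).*2 (d + e, e, e, d - e).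
  by rewrite ede; apply/and5P; split; nia.
by split; [exact: mbox|apply/andP; split; [exact: s|lia]|rewrite (negPf oe) subnK].
Qed.

(** At each doubling, even [k] reproduces the previous count, and odd [k] contributes its fixed
    points: none at first, since [b (a + b) = M] contradicts [a] odd, and afterwards one per divisor
    of [M], an even number. *)
Lemma odd_cross_even_pow2 j M : odd M -> nonsquare M -> odd (cross_even (2 ^ j * M)) = odd (cross_even M).
Proof.
move=> oM nsM; elim: j => [|j <-]; first by rewrite mul1n.
rewrite expnS -mulnA mul2n -(cross_even_double (2 ^ j * M)).
rewrite {1}/cross_even (nsol_split _ _ _ (fun k _ _ _ => odd k)) oddD odd_cross_even_odd_k.
case: j => [|j]; last by rewrite cross_even_fixed_count // size_divisors // odd_double.
rewrite mul1n nsol0 // => k b m a /= /and5P[_ _ _ _ /eqP e] /and3P[oa /eqP ek /eqP em].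
have e' : b * (a + b) = M by move: e; rewrite ek em; nia.
by rewrite -e' oddM oddD oa addTb andbN in oM.
Qed.

Lemma mulmod4 c d : (c * d) %% 4 = ((c %% 4) * (d %% 4)) %% 4 /\
  [\/ c %% 4 = 0, c %% 4 = 1, c %% 4 = 2 | c %% 4 = 3].
Proof.
split; first by rewrite modnMml modnMmr.
have : c %% 4 < 4 by rewrite ltn_mod.
by case: (c %% 4) => [|[|[|[|]]]] // _; constructor.
Qed.

(* Zagier's involution; its fixed points satisfy [m * (m + 4 * b) = M]. *)
Lemma odd_zagier M : odd M -> nonsquare M ->
  odd (nsol 4 1 M (fun _ _ m a => m == a)) =
  odd (nsol 4 1 M (fun k _ m a => (m == a) && (k == m))).
Proof.
move=> oM nsM.
rewrite (odd_nsol_invol (f := fun '(k, b, m, a) =>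
   if m + b < k then (b, k - m - b, m + b.*2, m + b.*2)
   else if m < k.*2 then (k, m + b - k, k.*2 - m, k.*2 - m)
   else (m + b - k, k, m - k.*2, m - k.*2))) //.
  congr odd; apply: eq_nsol => k b m a /= /and5P[k0 b0 m0 a0 /eqP e].
  by case: ltnP => h1; [|case: ltnP => h2]; rewrite !xpair_eqE; lia.
move=> k b m a /= /and5P[k0 b0 m0 a0 /eqP e] /eqP ema; rewrite -ema in e *.
case: ltnP => h1.
  have [c ek] : exists c, k = c.+1 + (m + b) by exists (k - (m + b)).-1; lia.
  rewrite {}ek in k0 h1 e *.
  have -> : (m + b.*2 + (c.+1 + (m + b) - m - b) < b) = false by lia.
  have -> : (m + b.*2 < b.*2) = false by lia.
  split; [by apply/and5P; split; nia|by []|].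
  by congr (_, _, _, _); lia.
case: ltnP => h2.
  (* The boundary [k = m + b] would give [M = (m + 2 b)^2]; the boundary [m = 2 k] is excluded below
     by the oddness of [M]. *)
  have kmb : k != m + b by apply/eqP => ek; apply: (nsM (m + b.*2)); rewrite -e ek; nia.
  have [c em] : exists c, m = c + (k - b) by exists (m - (k - b)); lia.
  have -> : (k.*2 - m + (m + b - k) < k) = false by lia.
  have -> : (k.*2 - m < k.*2) by lia.
  split; [|by []|by congr (_, _, _, _); lia].
  have [x ex] : exists x, x = k.*2 - m by eexists.
  have [y ey] : exists y, y = m + b - k by eexists.
  rewrite -ex -ey.
  have eb : b = y + k - m by lia.
  have xm : x + m = k.*2 by lia.
  by apply/and5P; split; nia.
have mk : m != k.*2.
  by apply: contraTneq oM => em; rewrite -e em oddD !oddM odd_double /=.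
have [c em] : exists c, m = c.+1 + k.*2 by exists (m - k.*2).-1; lia.
rewrite {}em in m0 h1 h2 mk e *.
have -> : (c.+1 + k.*2 - k.*2 + k < c.+1 + k.*2 + b - k) by lia.
split; [by rewrite addnK; apply/and5P; split; nia|by []|].
by congr (_, _, _, _); lia.
Qed.

(** At a fixed point, [m] is a divisor of [M] below the square root. Each such divisor occurs:
    [M = 1 mod 4] makes it congruent to its cofactor modulo 4. *)
Lemma odd_zagier_halfdiv M : M %% 4 = 1 -> nonsquare M ->
  odd (nsquares 4 M) = odd (halfdiv M).
Proof.
move=> M4 nsM; have oM : odd M by lia.
have M0 := nonsquare_gt0 nsM.
rewrite /nsquares -odd_nsol_square // odd_zagier //; congr odd.
rewrite /nsol -lock /halfdiv.
apply: (count_bij (f := fun '(_, _, m, _) => m)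
                  (g := fun d => (d, (M %/ d - d) %/ 4, d, d)));
  rewrite ?box_uniq ?divisors_uniq //.
  move=> -[[[k b] m] a] _ /andP[/and5P[k0 b0 m0 a0 /eqP e] /andP[/eqP ema /eqP ekm]].
  have e' : M = (m + 4 * b) * m by rewrite -e ekm -ema; nia.
  have -> : M %/ m = m + 4 * b by rewrite e' mulnK.
  rewrite -dvdn_divisors // addKn mulKn // ekm -ema; split => //; first by rewrite e' dvdn_mull.
  by rewrite e' ltn_pmul2r //; lia.
move=> d; rewrite -dvdn_divisors // => /dvdnP[c eM] dM.
have d0 : 0 < d by case: d eM {dM} => // eM; rewrite eM muln0 in M0.
have dc : d < c by rewrite eM ltn_pmul2r in dM.
have [f ec] : exists f, c = d + 4 * f.
  exists ((c - d) %/ 4); have : (c - d) %% 4 = 0; last by lia.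
  have [e4 c4] := mulmod4 c d; have [_ d4] := mulmod4 d c.
  by rewrite -eM M4 in e4; case: c4 d4 e4 => c4 [] d4; rewrite c4 d4 /=; lia.
have -> : M %/ d = c by rewrite eM mulnK.
rewrite ec addKn mulKn //.
have s : sol 4 1 M (d, f, d, d) by apply/and5P; split; rewrite ?eM ?ec; nia.
by split; [apply: sol_box s|apply/andP; split; [exact: s|rewrite eqxx]|].
Qed.

(** The map [d -> M / d] has no fixed point. It preserves the class of 3 modulo 4 if [M = 1 mod 4],
    and exchanges the classes of 1 and 3 if [M = 3 mod 4]. *)
Lemma count_divisors_3mod4 M : odd M -> nonsquare M ->
  odd (count (fun e => e %% 4 == 3) (divisors M)) = (M %% 4 == 3) && odd (halfdiv M).
Proof.
move=> oM nsM; have M0 := nonsquare_gt0 nsM.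
have divM d : d \in divisors M -> [/\ M %/ d \in divisors M, M %/ (M %/ d) = d,
    M %/ d != d & ((M %/ d) %% 4 * (d %% 4)) %% 4 = M %% 4].
  move=> dM; have [eM eK] := divisors_invol M0 dM; split=> //.
    by apply/eqP => ed; apply: (nsM d); rewrite -{1}ed divnK // dvdn_divisors.
  by rewrite modnMml modnMmr divnK // dvdn_divisors.
have [M3|M3] /= := eqVneq (M %% 4) 3; last first.
  rewrite (odd_count_invol (f := divn M)) ?divisors_uniq //; last first.
    move=> d dM /eqP d4; have [eM eK _ e4] := divM d dM; split=> //.
    have [_] := mulmod4 (M %/ d) d; rewrite d4 in e4.
    by case=> c4; rewrite c4 in e4 *; rewrite /= in e4; lia.
  rewrite (eq_in_count (a2 := pred0)) ?count_pred0 // => d dM /=.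
  by have [_ _ /negPf-> _] := divM d dM; rewrite andbF.
suff -> : count (fun e => e %% 4 == 3) (divisors M) = halfdiv M by [].
apply: double_inj; rewrite -size_divisors //.
rewrite -(count_predC (fun e => e %% 4 == 3) (divisors M)) -addnn; congr (_ + _).
apply: (count_bij (f := divn M) (g := divn M)); rewrite ?divisors_uniq // => d dM /=;
  have [eM eK _ e4] := divM d dM; have [_ c4] := mulmod4 (M %/ d) d;
  have [_ d4'] := mulmod4 d d => d4; split=> //;
  by case: c4 d4' e4 d4 => -> [] ->; rewrite M3.
Qed.

Lemma odd_halfK x y : odd x = odd y -> 0 < y < x ->
  exists s d, [/\ x = s + d, y = s - d, d < s & 0 < d].
Proof.
move=> xy /andP[y0 yx]; exists (x + y)./2, (x - y)./2.
have := odd_double_half (x + y); have := odd_double_half (x - y).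
rewrite oddD (oddB (ltnW yx)) xy addbb !add0n => e1 e2.
by split; lia.
Qed.

(** Half the sum and half the difference of [k] and [m] have squares adding up to [M], hence
    opposite parities; the even one is halved again. *)
Lemma two_odd_squares M : odd M ->
  nsol 1 1 M.*2 (fun k b m a => [&& odd a, odd k, m < k, k == b & m == a]) = nsquares 4 M.
Proof.
move=> oM.
apply: (nsol_bij
  (f := fun '(k, b, m, a) => let s := (k + m)./2 in let d := (k - m)./2 in
        if odd s then (d./2, d./2, s, s) else (s./2, s./2, d, d))
  (* With truncated subtraction, [q] is the absolute value of [m - 2 k]. *)
  (g := fun '(k, b, m, a) => let p := m + k.*2 in let q := (m - k.*2) + (k.*2 - m) in
        (p, p, q, q))) => // k b m a /=.
  move=> /and5P[k0 b0 m0 a0 /eqP e] /and5P[oa ok mk /eqP ekb /eqP ema].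
  rewrite -ekb -ema in e oa *.
  have [||s [d [ek em ds d0]]] := odd_halfK (x := k) (y := m).
    by rewrite ok oa.
    by rewrite m0.
  have -> : (k + m)./2 = s by lia.
  have -> : (k - m)./2 = d by lia.
  have esd : s * s + d * d = M by move: e; rewrite ek em; nia.
  have := congr1 odd esd; rewrite oM oddD !oddM !andbb.
  case os: (odd s) => /= od.
    have ed : d./2.*2 = d by have := odd_double_half d; lia.
    set h := d./2 in ed *; rewrite -ed in d0 ds esd ek em *.
    split; [by apply/and5P; split; first [lia|nia]|by rewrite !eqxx|].
    by congr (_, _, _, _); lia.
  have ed : s./2.*2 = s by have := odd_double_half s; lia.
  set h := s./2 in ed *; rewrite -ed in ds esd ek em *.
  split; [by apply/and5P; split; first [lia|nia]|by rewrite !eqxx|].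
  by congr (_, _, _, _); lia.
move=> /and5P[k0 b0 m0 a0 /eqP e] /andP[/eqP ekb /eqP ema].
rewrite -ekb -ema in e *.
have om : odd m by have := congr1 odd e; rewrite oM oddD !oddM; lia.
have [mk|km] := ltnP m k.*2.
  have [c ek] : exists c, k.*2 = m + c by exists (k.*2 - m); lia.
  have -> : m - k.*2 + (k.*2 - m) = c by lia.
  have c2 : 4 * (k * k) = (m + c) * (m + c) by rewrite -ek; lia.
  split; [by apply/and5P; split; first [lia|nia]|by rewrite !eqxx; lia|].
  have -> : (m + k.*2 + c)./2 = k.*2 by lia.
  have -> : (m + k.*2 - c)./2 = m by lia.
  by rewrite odd_double doubleK.
have [c ek] : exists c, m = k.*2 + c by exists (m - k.*2); lia.
have -> : m - k.*2 + (k.*2 - m) = c by lia.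
rewrite ek in om e *.
split; [by apply/and5P; split; first [lia|nia]|by rewrite !eqxx; lia|].
have -> : (k.*2 + c + k.*2 + c)./2 = k.*2 + c by lia.
have -> : (k.*2 + c + k.*2 - c)./2 = k.*2 by lia.
by rewrite om doubleK.
Qed.

(** Odd squares are 1 modulo 8, so [2 M = k^2 + m^2] forces [M = 1 mod 4]. *)
Lemma no_two_odd_squares M : M %% 4 = 3 \/ ~~ odd M ->
  nsol 1 1 M.*2 (fun k b m a => [&& odd a, odd k, m < k, k == b & m == a]) = 0.
Proof.
move=> M4; apply: nsol0 => k b m a /= /and5P[k0 b0 m0 a0 /eqP e] /and5P[oa ok mk /eqP ekb /eqP ema].
rewrite -ekb -ema in e oa.
have [k' ek] : exists k', k = k'.*2.+1 by exists k./2; lia.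
have [m' em] : exists m', m = m'.*2.+1 by exists m./2; lia.
have : odd ((k' * k'.+1)) = false by rewrite oddM /=; case: odd.
have : odd ((m' * m'.+1)) = false by rewrite oddM /=; case: odd.
have : M = 2 * (k' * k'.+1) + 2 * (m' * m'.+1) + 1 by move: e; rewrite ek em; nia.
lia.
Qed.

Lemma count_halfdiv M : odd M -> nonsquare M ->
  nsol 1 1 M.*2 (fun k b m a => [&& odd b, odd k, b < k, k == a & m == b]) = halfdiv M.
Proof.
move=> oM nsM; have M0 := nonsquare_gt0 nsM.
rewrite /nsol -lock /halfdiv.
apply: (count_bij (f := fun '(_, b, _, _) => b) (g := fun d => (M %/ d, d, d, M %/ d)));
  rewrite ?box_uniq ?divisors_uniq //.
  move=> -[[[k b] m] a] _ /andP[/and5P[k0 b0 m0 a0 /eqP e] /and5P[ob ok bk /eqP eka /eqP emb]].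
  have e' : M = k * b by move: e; rewrite -eka emb; nia.
  rewrite -dvdn_divisors // -eka emb e' mulnK // dvdn_mull //.
  by split=> //; rewrite ltn_pmul2r.
move=> d; rewrite -dvdn_divisors // => /dvdnP[c eM] dM.
have d0 : 0 < d by case: d eM {dM} => // eM; rewrite eM muln0 in M0.
have dc : d < c by rewrite eM ltn_pmul2r in dM.
have -> : M %/ d = c by rewrite eM mulnK.
have /andP[oc od] : odd c && odd d by rewrite -oddM -eM.
have s : sol 1 1 M.*2 (c, d, d, c) by apply/and5P; split; rewrite ?eM; first [lia|nia].
by split; [apply: sol_box s|apply/andP; split; [exact: s|rewrite od oc dc !eqxx]|].
Qed.

(** With [s = (k + m) / 2] the equation is [b s = M], with [m] odd and [m < s]. The involution
    [m -> s - 1 - m] fixes [m] when [s = 2 m + 1], so fixed points correspond to divisors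
    [s = 3 mod 4]. *)
Lemma odd_count_b_km M : odd M -> nonsquare M ->
  odd (nsol 1 1 M.*2 (fun k b m a => [&& odd a, odd k, m < k & a == b])) =
  (M %% 4 == 3) && odd (halfdiv M).
Proof.
move=> oM nsM; have M0 := nonsquare_gt0 nsM; rewrite -count_divisors_3mod4 //.
rewrite (odd_nsol_invol (f := fun '(k, b, m, a) =>
  let e := (k + m)./2 in (e.+1 + m, b, e - 1 - m, a))) //=; last first.
  move=> k b m a /and5P[k0 b0 m0 a0 /eqP e] /and4P[oa ok mk /eqP eab].
  rewrite eab in e oa *.
  have om : odd m by have := congr1 odd e; rewrite odd_double oddD !oddM; lia.
  have [s es] : exists s, k + m = s.*2 by exists (k + m)./2; lia.
  have eM : b * s = M by nia.
  have os : odd s by move: oM; rewrite -eM oddM oa.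
  have -> : (k + m)./2 = s by lia.
  have ms : m.+1 < s.
    by have : m.+1 != s by [apply: contraTneq os => <-; rewrite /= om]; lia.
  have -> : uphalf (s + m + (s - 1 - m)) = s by lia.
  have [c ec] : exists c, s = m.+1 + c by exists (s - m.+1); lia.
  split; last by congr (_, _, _, _); lia.
    have -> : s - 1 - m = c by lia.
    have c0 : 0 < c by lia.
    by rewrite b0 c0 ec -eM; apply/eqP; lia.
  by rewrite eqxx oa; lia.
congr odd; rewrite /nsol -lock.
apply: (count_bij (f := fun '(_, _, m, _) => m.*2.+1)
  (g := fun e => ((e./2 + e).+1, M %/ e, e./2, M %/ e)));
  rewrite ?box_uniq ?divisors_uniq //.
  move=> -[[[k b] m] a] _ /andP[/and5P[k0 b0 m0 a0 /eqP e] /andP[/and4P[oa ok mk /eqP eab]]].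
  rewrite !xpair_eqE !eqxx andbT eab in e oa * => /andP[/andP[/eqP e1 _] /eqP e2].
  have om : odd m by have := congr1 odd e; rewrite odd_double oddD !oddM; lia.
  have ek : k = 3 * m + 2 by lia.
  have e' : M = b * m.*2.+1 by move: e; rewrite ek; nia.
  have -> : M %/ m.*2.+1 = b by rewrite e' mulnK.
  by rewrite -dvdn_divisors // e' dvdn_mull //; split=> //; [lia|congr (_, _, _, _); lia].
move=> e; rewrite -dvdn_divisors // => /dvdnP[c eM] /eqP e4.
have e0 : 0 < e by lia.
have -> : M %/ e = c by rewrite eM mulnK.
have c0 : 0 < c by case: c eM => // eM; rewrite eM in M0.
have /andP[oc _] : odd c && odd e by rewrite -oddM -eM.
have [m em] : exists m, e = m.*2.+1 by exists e./2; lia.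
have -> : e./2 = m by lia.
have s : sol 1 1 M.*2 ((m + e).+1, c, m, c) by apply/and5P; split; rewrite ?eM ?em; first [lia|nia].
split; [exact: sol_box s| |lia].
apply/andP; split; first exact: s.
by rewrite !xpair_eqE !eqxx oc; lia.
Qed.

(** Here [s = (k + m) / 2] is even, and the involution is [m -> s - m]. Fixed points have [k = 3 m]
    and [b m = 2^j M] with [b], [m] odd: none if [j > 0], one per divisor of [M] if [j = 0]. *)
Lemma even_count_b_km j M : odd M -> nonsquare M ->
  ~~ odd (nsol 1 1 (2 ^ j.+1 * M).*2 (fun k b m a => [&& odd a, odd k, m < k & a == b])).
Proof.
move=> oM nsM; have M0 := nonsquare_gt0 nsM.
rewrite expnS -mulnA mul2n.
rewrite (odd_nsol_invol (f := fun '(k, b, m, a) =>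
  let t := (k - m)./2 in (k + m - t, b, t, a))) //=; last first.
  move: (2 ^ j * M) => N k b m a /and5P[k0 b0 m0 a0 /eqP e] /and4P[oa ok mk /eqP eab].
  rewrite eab in e oa *.
  have om : odd m by have := congr1 odd e; rewrite odd_double oddD !oddM; lia.
  have [s es] : exists s, k + m = s.*2 by exists (k + m)./2; lia.
  have bs : b * s = N.*2 by nia.
  have even_s : ~~ odd s by have := congr1 odd bs; rewrite odd_double oddM oa /= => ->.
  have [t et] : exists t, k = t.*2 + m by exists (k - m)./2; lia.
  have -> : (k - m)./2 = t by lia.
  have -> : k + m - t = t + m.*2 by lia.
  have ot : odd t by lia.
  split; [|by lia|by congr (_, _, _, _); lia].
  rewrite et in e es; apply/and5P; split; try lia.
case: j => [|j]; last first.
  rewrite nsol0 // => k b m a /and5P[k0 b0 m0 a0 /eqP e] /andP[/and4P[oa ok mk /eqP eab]].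
  rewrite !xpair_eqE !eqxx andbT eab in e oa * => /andP[/andP[/eqP e1 _] /eqP e2].
  have ek : k = 3 * m by lia.
  have e' : m * b = 2 ^ j.+1 * M by move: e; rewrite ek; lia.
  have := congr1 odd e'; rewrite !oddM oddX oa /= andbT => om.
  by rewrite ek oddM om in ok.
suff -> : nsol 1 1 (2 ^ 0 * M).*2.*2 (fun k b m a =>
    [&& odd a, odd k, m < k & a == b] &&
    (((k + m - (k - m)./2), b, (k - m)./2, a) == (k, b, m, a))) = size (divisors M).
  by rewrite size_divisors // odd_double.
rewrite mul1n -(count_predT (divisors M)) /nsol -lock.
apply: (count_bij (f := fun '(_, _, m, _) => m)
  (g := fun d => (d.*2 + d, M %/ d, d, M %/ d))); rewrite ?box_uniq ?divisors_uniq //.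
  move=> -[[[k b] m] a] _ /andP[/and5P[k0 b0 m0 a0 /eqP e] /andP[/and4P[oa ok mk /eqP eab]]].
  rewrite !xpair_eqE !eqxx andbT eab in e oa * => /andP[/andP[/eqP e1 _] /eqP e2].
  have ek : k = m.*2 + m by lia.
  have e' : M = b * m by move: e; rewrite ek; lia.
  have -> : M %/ m = b by rewrite e' mulnK.
  by rewrite -dvdn_divisors // e' dvdn_mull // ek.
move=> d; rewrite -dvdn_divisors // => /dvdnP[c eM] _.
have d0 : 0 < d by case: d eM => // eM; rewrite eM muln0 in M0.
have -> : M %/ d = c by rewrite eM mulnK.
have c0 : 0 < c by case: c eM => // eM; rewrite eM in M0.
have /andP[oc od] : odd c && odd d by rewrite -oddM -eM.
have s : sol 1 1 M.*2.*2 (d.*2 + d, c, d, c) by apply/and5P; split; rewrite ?eM; lia.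
split; [exact: sol_box s| |by []].
by apply/andP; split; [exact: s|rewrite !xpair_eqE !eqxx oc; lia].
Qed.

(** For [j > 0] the outer terms of [odd_nsol_all_odd] vanish and the middle one is even. For [j = 0]
    the last term is [halfdiv M]; it cancels modulo 2 with the first if [M = 1 mod 4], and with the
    second if [M = 3 mod 4]. *)
Lemma even_nsol_all_odd j M : odd M -> nonsquare M ->
  ~~ odd (nsol 1 1 (2 ^ j * M).*2 (fun k b m a => [&& odd a, odd b, odd k & m < k])).
Proof.
move=> oM nsM; rewrite odd_nsol_all_odd !oddD.
case: j => [|j]; last first.
  rewrite no_two_odd_squares; last by right; rewrite oddM oddX.
  rewrite (negPf (even_count_b_km _ _ _)) //= nsol0 //.
  move=> k b m a /and5P[k0 b0 m0 a0 /eqP e] /and5P[ob ok bk /eqP eka /eqP emb].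
  have e' : k * b = 2 ^ j.+1 * M by move: e; rewrite -eka emb; lia.
  by have := congr1 odd e'; rewrite !oddM ob ok oddX.
rewrite mul1n count_halfdiv // odd_count_b_km //.
have [M1|M3] : M %% 4 = 1 \/ M %% 4 = 3 by lia.
  by rewrite M1 two_odd_squares // odd_zagier_halfdiv //= addbF addbb.
by rewrite M3 no_two_odd_squares ?addbb //; left.
Qed.

Lemma odd_cross_pow2 j M : odd M -> nonsquare M -> odd (cross (2 ^ j * M)) = odd (nsquares 2 M).
Proof.
move=> oM nsM; rewrite -odd_cross_of_odd // !cross_split !oddD odd_cross_even_pow2 //; congr (_ (+) _).
elim: j => [|j <-]; first by rewrite mul1n.
by rewrite expnS -mulnA mul2n cross_odd_double oddD (negPf (even_nsol_all_odd _ _ _)).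
Qed.

(** * Representations by [2 y^2 + x^2] *)

Lemma odd_sqr_mod8 x : odd x -> exists t, x * x = 8 * t + 1.
Proof.
move=> ox; have [y ey] : exists y, x = y.*2.+1 by exists x./2; lia.
have : odd (y * y.+1) = false by rewrite oddM /=; case: odd.
move=> oy; have [t et] : exists t, y * y.+1 = t.*2 by exists (y * y.+1)./2; lia.
by exists t; rewrite ey; nia.
Qed.

Lemma nsquares_even u M : 0 < u ->
  (forall k m, u * (k * k) + m * m = M -> ~~ odd k) -> nsquares u M = nsquares (4 * u) M.
Proof.
move=> u0 even_k.
apply: (nsol_bij (f := fun '(k, b, m, a) => (k./2, b./2, m, a))
                 (g := fun '(k, b, m, a) => (k.*2, b.*2, m, a))); rewrite ?muln_gt0 //.
  move=> k b m a /= /and5P[k0 b0 m0 a0 /eqP e] /andP[/eqP ekb /eqP ema].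
  have e' : u * (k * k) + m * m = M by rewrite -e -ekb -ema mul1n.
  have ek : k./2.*2 = k by have := even_k _ _ e'; lia.
  rewrite -ekb -ema ek !eqxx; split => //.
  by apply/and5P; split; rewrite -?e' -1?{5 6}ek; lia.
move=> k b m a /= /and5P[k0 b0 m0 a0 /eqP e] /andP[/eqP ekb /eqP ema].
by rewrite -ekb -ema doubleK !eqxx; split => //; apply/and5P; split; rewrite -?e; lia.
Qed.

(** If [k] were odd, the left side would be [u + 1] modulo 8. *)
Lemma mod8_even_k u M : (u == 2) || (u == 4) -> M %% 8 = 1 ->
  forall k m, u * (k * k) + m * m = M -> ~~ odd k.
Proof.
move=> u24 M8 k m e; apply/negP => /odd_sqr_mod8[t et].
have om : odd m.
  have oM : odd M by lia.
  by have := congr1 odd e; rewrite oM oddD !oddM; case/orP: u24 => /eqP->; lia.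
by have [s es] := odd_sqr_mod8 om; rewrite et es in e; case/orP: u24 e => /eqP-> e; lia.
Qed.

(** Swapping [k] with [b] passes to [x^2 + 8 k b = M]. The solutions with even [b] solve
    [x^2 + 16 k b = M], where the same swap leads back to squares. *)
Lemma odd_nsquares8_split M :
  odd (nsquares 8 M) = odd (nsol 8 1 M (fun k b m a => (m == a) && odd b)) (+) odd (nsquares 16 M).
Proof.
rewrite /nsquares -!odd_nsol_square // (nsol_split _ _ _ (fun _ b _ _ => odd b)) oddD.
congr (_ (+) odd _).
apply: (nsol_bij (f := fun '(k, b, m, a) => (k, b./2, m, a))
                 (g := fun '(k, b, m, a) => (k, b.*2, m, a))) => // k b m a /=.
  move=> /and5P[k0 b0 m0 a0 /eqP e] /andP[ema ob].
  have eb : b./2.*2 = b by lia.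
  set h := b./2 in eb *; rewrite -eb in e b0 *.
  by rewrite ema; split => //; apply/and5P; split; lia.
move=> /and5P[k0 b0 m0 a0 /eqP e] ema.
by rewrite doubleK odd_double ema; split => //; apply/and5P; split; lia.
Qed.

Lemma nsquares_mod8_7 M : M %% 8 = 7 -> nsquares 2 M = 0.
Proof.
move=> M8; apply: nsol0 => k b m a /= /and5P[k0 b0 m0 a0 /eqP e] /andP[/eqP ekb /eqP ema].
rewrite -ekb -ema in e.
have oM : odd M by lia.
have om : odd m.
  by have := congr1 odd e; rewrite oM oddD !oddM; lia.
have [s es] := odd_sqr_mod8 om.
have [ok|ek] := boolP (odd k); first by have [t et] := odd_sqr_mod8 ok; lia.
have [h eh] : exists h, k = h.*2 by exists k./2; lia.
by rewrite eh in e; lia.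
Qed.

(** If 3 divided one of [x], [y], it would divide both, and 9 would divide [3 K]. *)
Lemma nsquares_3K_mod3 K x y : K %% 3 != 0 -> 2 * (y * y) + x * x = 3 * K ->
  (x %% 3 != 0) && (y %% 3 != 0).
Proof.
move=> K3.
have [t [r ex]] : exists t r, x = 3 * t + r /\ r < 3.
  by exists (x %/ 3), (x %% 3); rewrite ltn_mod; lia.
have [s [r' ey]] : exists t r, y = 3 * t + r /\ r < 3.
  by exists (y %/ 3), (y %% 3); rewrite ltn_mod; lia.
case: ex ey => -> r3 [-> r3'].
by case: r r' r3 r3' => [|[|[|//]]] [|[|[|//]]] _ _; lia.
Qed.

(* With z = x + y * sqrt(-2), the involution multiplies z or its conjugate by
   (1 - sqrt(-2)) / (1 + sqrt(-2)), whichever product is integral, and takes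
   absolute values of coordinates. *)
Lemma even_nsquares_3K K : odd K -> K %% 3 != 0 -> nonsquare K -> ~~ odd (nsquares 2 (3 * K)).
Proof.
move=> oK K3 nsK.
rewrite /nsquares (odd_nsol_invol (f := fun '(y, b, x, a) =>
   if x %% 3 == y %% 3 then
     let y' := (2 * x + y) %/ 3 in let x' := (4 * y - x + (x - 4 * y)) %/ 3 in (y', y', x', x')
   else let y' := (2 * x - y + (y - 2 * x)) %/ 3 in let x' := (x + 4 * y) %/ 3 in
        (y', y', x', x'))) //.
  (* A fixed point has [x = y], hence [K = y^2], or [x = 2 y], hence [K = 2 y^2]. *)
  rewrite nsol0 // => y b x a /= /and5P[y0 _ x0 _ /eqP e] /andP[/andP[/eqP eyb /eqP exa]].
  rewrite -eyb -exa mul1n in e *; have /andP[x3 y3] := nsquares_3K_mod3 K3 e.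
  case: (eqVneq (x %% 3) (y %% 3)) => xy; rewrite /= !xpair_eqE => /andP[/andP[/andP[/eqP e1 _] /eqP e2] _].
    have exy : x = y by lia.
    by apply: (nsK y); rewrite exy in e; lia.
  have exy : x = 2 * y by lia.
  have : K = 2 * (y * y) by rewrite exy in e; lia.
  by move=> eK; rewrite eK oddM in oK.
move=> y b x a /= /and5P[y0 _ x0 _ /eqP e] /andP[/eqP eyb /eqP exa].
rewrite -eyb -exa mul1n in e *; have /andP[x3 y3] := nsquares_3K_mod3 K3 e.
have solE p q : 0 < p -> 0 < q -> 2 * (q * q) + p * p = 3 * K ->
    [&& 0 < q, 0 < q, 0 < p, 0 < p & 2 * (q * q) + 1 * (p * p) == 3 * K].
  by move=> -> ->; rewrite mul1n => ->; rewrite eqxx.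
(* The image stays in its branch when [4 y - x], respectively [2 x - y], is positive; dropping a
   negative sign moves it to the other branch. Neither is zero, since 3 does not divide [K]. *)
case: (eqVneq (x %% 3) (y %% 3)) => xy.
  have [le|lt] := leqP x (4 * y).
    have [p ep] : exists p, x + 3 * p = 4 * y by exists ((4 * y - x) %/ 3); lia.
    have [q eq] : exists q, q + 2 * p = 3 * y by exists (3 * y - 2 * p); lia.
    have -> : (4 * y - x + (x - 4 * y)) %/ 3 = p by lia.
    have -> : (2 * x + y) %/ 3 = q by lia.
    have p0 : 0 < p.
      case: (posnP p) => // p0; have ex : x = 4 * y by lia.
      have eK : K = 6 * (y * y) by rewrite ex in e; lia.
      by rewrite eK in K3; lia.
    have q0 : 0 < q by lia.
    have e' : 2 * (q * q) + p * p = 3 * K.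
      have h1 : (x + 3 * p) * (x + 3 * p) = (4 * y) * (4 * y) by rewrite ep.
      have h2 : (x + 3 * p) * p = (4 * y) * p by rewrite ep.
      have h3 : (q + 2 * p) * (q + 2 * p) = (3 * y) * (3 * y) by rewrite eq.
      have h4 : (q + 2 * p) * p = (3 * y) * p by rewrite eq.
      lia.
    have -> : p %% 3 == q %% 3 by lia.
    split; [exact: solE|by rewrite !eqxx|by congr (_, _, _, _); lia].
  have [p ep] : exists p, x = 4 * y + 3 * p by exists ((x - 4 * y) %/ 3); lia.
  have [q eq] : exists q, q = 3 * y + 2 * p by eexists.
  have -> : (4 * y - x + (x - 4 * y)) %/ 3 = p by lia.
  have -> : (2 * x + y) %/ 3 = q by lia.
  have e' : 2 * (q * q) + p * p = 3 * K by rewrite eq -e ep; lia.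
  have /andP[p3 q3] := nsquares_3K_mod3 K3 e'.
  have -> : p %% 3 == q %% 3 = false by lia.
  split; [by apply: solE e'; lia|by rewrite !eqxx|by congr (_, _, _, _); lia].
have [p ep] : exists p, x + 4 * y = 3 * p by exists ((x + 4 * y) %/ 3); lia.
have -> : (x + 4 * y) %/ 3 = p by lia.
have h1 : (x + 4 * y) * (x + 4 * y) = (3 * p) * (3 * p) by rewrite ep.
have h2 : (x + 4 * y) * y = (3 * p) * y by rewrite ep.
have [le|lt] := leqP y (2 * x).
  have [q eq] : exists q, q + 3 * y = 2 * p by exists (2 * p - 3 * y); lia.
  have -> : (2 * x - y + (y - 2 * x)) %/ 3 = q by lia.
  have q0 : 0 < q.
    case: (posnP q) => // q0; have ey : y = 2 * x by lia.
    have eK : K = 3 * (x * x) by rewrite ey in e; lia.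
    by rewrite eK in K3; lia.
  have e' : 2 * (q * q) + p * p = 3 * K.
    have h3 : (q + 3 * y) * (q + 3 * y) = (2 * p) * (2 * p) by rewrite eq.
    have h4 : (q + 3 * y) * y = (2 * p) * y by rewrite eq.
    lia.
  have /andP[p3 q3] := nsquares_3K_mod3 K3 e'.
  have -> : p %% 3 == q %% 3 = false by lia.
  split; [by apply: solE e'; lia|by rewrite !eqxx|by congr (_, _, _, _); lia].
have [q eq] : exists q, q + 2 * p = 3 * y by exists (3 * y - 2 * p); lia.
have -> : (2 * x - y + (y - 2 * x)) %/ 3 = q by lia.
have e' : 2 * (q * q) + p * p = 3 * K.
  have h3 : (q + 2 * p) * (q + 2 * p) = (3 * y) * (3 * y) by rewrite eq.
  have h4 : (q + 2 * p) * p = (3 * y) * p by rewrite eq.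
  lia.
have -> : p %% 3 == q %% 3 by lia.
split; [by apply: solE e'; lia|by rewrite !eqxx|by congr (_, _, _, _); lia].
Qed.

(** * Gauss's identity for the triangular numbers, and its logarithmic derivative modulo 2 *)

Section ShanksIdentity.
Import GRing.Theory.
Local Open Scope ring_scope.
Variable R : comNzRingType.
Implicit Types s n : nat.

(** Truncations of Gauss's identity, in which [psi] times the product of all [1 - q^(2k-1)] equals
    the product of all [1 - q^(2k)]. The lower bound [s] serves the cleared denominators in
    [shanks]. *)
Definition evenp s n : {poly R} := \prod_(s <= k < n) (1 - 'X^(k.+1.*2)).
Definition oddp n : {poly R} := \prod_(k < n) (1 - 'X^(k.*2.+1)).
Definition psi n : {poly R} := \sum_(t < n.*2) 'X^'C(t.+1, 2).

(* Shanks' finite form of Gauss's identity for the triangular numbers, with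
   denominators cleared. *)
Lemma shanks n :
  oddp n * psi n = \sum_(0 <= s < n) 'X^(s * n.*2.+1) * oddp s * evenp s n.
Proof.
elim: n => [|n IHn]; first by rewrite /psi !big_ord0 mulr0 big_geq.
have psiS : psi n.+1 = psi n + 'X^(n * n.*2.+1) + 'X^(n.+1 * n.*2.+1).
  rewrite /psi doubleS !big_ord_recr /=; congr (_ + 'X^_ + 'X^_); rewrite bin2; lia.
have oddpS s : oddp s.+1 = oddp s * (1 - 'X^(s.*2.+1)) by rewrite /oddp big_ord_recr.
(* From [n] to [n + 1] each summand is multiplied by [1 - X^(2n+1)], up to the difference
   [G (s+1) - G s]. The factor [1 - X^(2s)] makes [G 0] vanish, so telescoping leaves only [G n]. *)
pose G s : {poly R} := 'X^(s * n.*2.+1) * oddp s * (1 - 'X^(s.*2)) * evenp s n.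
have step s : (s < n)%N ->
    'X^(s * n.+1.*2.+1) * oddp s * evenp s n.+1 =
    (1 - 'X^(n.*2.+1)) * ('X^(s * n.*2.+1) * oddp s * evenp s n) + (G s.+1 - G s).
  move=> sn; rewrite /G oddpS.
  have -> : evenp s n.+1 = evenp s n * (1 - 'X^(n.+1.*2)).
    by rewrite /evenp big_nat_recr // ltnW.
  have -> : evenp s n = (1 - 'X^(s.+1.*2)) * evenp s.+1 n by rewrite /evenp big_ltn.
  have -> : (s * n.+1.*2.+1 = s * n.*2.+1 + s.*2)%N by lia.
  have -> : (s.+1 * n.*2.+1 = s * n.*2.+1 + n.*2.+1)%N by lia.
  rewrite !doubleS !exprD !exprS; ring.
rewrite psiS oddpS big_nat_recr //= (eq_big_nat _ _ (F2 := fun s =>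
  (1 - 'X^(n.*2.+1)) * ('X^(s * n.*2.+1) * oddp s * evenp s n) + (G s.+1 - G s)));
  last by move=> s /andP[_ /step].
rewrite big_split /= -mulr_sumr -IHn telescope_sumr // /G mul0n double0 expr0 subrr mulr0 mul0r subr0.
rewrite {1}/evenp big_geq // /evenp big_nat1.
have -> : (n * n.+1.*2.+1 = n * n.*2.+1 + n.*2)%N by lia.
have -> : (n.+1 * n.*2.+1 = n * n.*2.+1 + n.*2.+1)%N by lia.
rewrite !doubleS !exprD !exprS; ring.
Qed.

End ShanksIdentity.

Section GaussModulo2.
Import GRing.Theory.
Local Open Scope ring_scope.

Lemma poly_F2_opp (p : {poly 'F_2}) : - p = p.
Proof.
apply/eqP; rewrite -subr_eq0 -opprD oppr_eq0 -mulr2n -scaler_nat.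
have -> : 2%:R = 0 :> 'F_2 by apply/val_inj.
by rewrite scale0r.
Qed.

Lemma poly_F2_natr (p : {poly 'F_2}) n : p *+ n = p *+ odd n.
Proof.
have pp (q : {poly 'F_2}) : q + q = 0 by rewrite -{2}[q]poly_F2_opp subrr.
by rewrite -{1}(odd_double_half n) mulrnDr -muln2 mulrnA mulr2n pp addr0.
Qed.

(** Only even powers of [X] occur, so the even product drops out of the logarithmic derivative in
    characteristic 2. *)
Lemma evenp_deriv s n : (evenp 'F_2 s n)^`() = 0.
Proof.
rewrite /evenp; elim/big_rec: _ => [|k p _ IHp]; first by rewrite derivC.
rewrite derivM IHp mulr0 addr0 derivB derivC derivXn poly_F2_natr odd_double.
by rewrite mulr0n subr0 mul0r.
Qed.

(** The Lambert series of [X^(2i+1) / (1 - X^(2i+1))], truncated: modulo 2 it is [X] times the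
    logarithmic derivative of [oddp]. *)
Definition odd_divisor_sum (n K : nat) : {poly 'F_2} :=
  \sum_(i < n) \sum_(k < K) 'X^(k.+1 * i.*2.+1).

(** For a factor [f = 1 - X^(2i+1)], modulo 2, [X f' = X^(2i+1)], which is [f] times [K] terms of a
    geometric series, up to a multiple of [X^(K+1)]. *)
Lemma oddp_deriv n K : exists r,
  'X * (oddp 'F_2 n)^`() = oddp 'F_2 n * odd_divisor_sum n K + 'X^(K.+1) * r.
Proof.
elim: n => [|n [r IHn]].
  by exists 0; rewrite /oddp /odd_divisor_sum !big_ord0 derivC !mulr0 addr0.
have geo : 'X^(n.*2.+1) = (1 - 'X^(n.*2.+1)) * \sum_(k < K) 'X^(k.+1 * n.*2.+1)
    + 'X^(K.+1) * 'X^(K.+1 * n.*2) :> {poly 'F_2}.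
  have -> : \sum_(k < K) 'X^(k.+1 * n.*2.+1) =
            'X^(n.*2.+1) * \sum_(k < K) 'X^(n.*2.+1) ^+ k :> {poly 'F_2}.
    by rewrite mulr_sumr; apply: eq_bigr => k _; rewrite -exprM -exprD mulnC mulnS.
  rewrite mulrCA -opprB mulNr -subrX1 -exprM -exprD -mulnS mulrN mulrBr mulr1.
  rewrite -exprD -mulnS mulnC; ring.
set f := 1 - 'X^(n.*2.+1) in geo.
have Xf : 'X * f^`() = 'X^(n.*2.+1) :> {poly 'F_2}.
  rewrite /f derivB derivC derivXn poly_F2_natr /= odd_double mulr1n sub0r poly_F2_opp.
  by rewrite -exprS.
exists (r * f + oddp _ n * 'X^(K.+1 * n.*2)).
rewrite /oddp big_ord_recr /= -/(oddp _ n) -/f derivM mulrDr mulrA IHn.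
rewrite mulrCA Xf {1}geo /odd_divisor_sum big_ord_recr /= -/(odd_divisor_sum n K).
ring.
Qed.

(** Modulo [X^(2n+1)] only the summand [s = 0] of [shanks] survives, so [oddp * psi] is [evenp 0 n].
    Differentiating and multiplying by [X] kills it, and [oddp], with constant term 1, can be
    cancelled. *)
Lemma Xn_dvd_odd_divisor_sum n : (0 < n)%N ->
  'X^(n.*2.+1) %| odd_divisor_sum n n.*2 * psi 'F_2 n + 'X * (psi 'F_2 n)^`().
Proof.
move=> n0; rewrite -(@Gauss_dvdpr _ _ (oddp 'F_2 n)); last first.
  apply: coprimep_expl; rewrite coprimep_sym coprimepX /root /oddp horner_prod.
  rewrite big1 ?oner_eq0 // => k _.
  by rewrite hornerD hornerN hornerC hornerXn expr0n subr0.
have [r dodd] := oddp_deriv n n.*2.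
case: n n0 r dodd => // n _ r dodd.
have [r' eq_r'] : exists r', oddp 'F_2 n.+1 * psi 'F_2 n.+1 =
    evenp 'F_2 0 n.+1 + 'X^(n.+1.*2.+1) * r'.
  rewrite shanks big_nat_recl // mul0n expr0 mul1r {1}/oddp big_ord0 mul1r.
  exists (\sum_(0 <= i < n) 'X^(i * n.+1.*2.+1) * oddp 'F_2 i.+1 * evenp 'F_2 i.+1 n.+1).
  by rewrite mulr_sumr; congr (_ + _); apply: eq_bigr => i _; rewrite mulSn exprD !mulrA.
have /(congr1 (fun p => 'X * p^`())) := eq_r'.
rewrite derivM mulrDr mulrA dodd derivD evenp_deriv add0r derivM derivXn poly_F2_natr.
rewrite /= odd_double mulr1n => e.
have -> : oddp 'F_2 n.+1 * (odd_divisor_sum n.+1 n.+1.*2 * psi 'F_2 n.+1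
    + 'X * (psi 'F_2 n.+1)^`()) =
    'X^(n.+1.*2.+1) * (r' + 'X * r'^`() - r * psi 'F_2 n.+1).
  apply: (addIr ('X^(n.+1.*2.+1) * r * psi 'F_2 n.+1)).
  transitivity ((oddp 'F_2 n.+1 * odd_divisor_sum n.+1 n.+1.*2 + 'X^(n.+1.*2.+1) * r)
    * psi 'F_2 n.+1 + 'X * (oddp 'F_2 n.+1 * (psi 'F_2 n.+1)^`())); first by ring.
  rewrite e [in 'X^(_.+1)]exprS; ring.
exact: dvdp_mulIl.
Qed.

(** The coefficient of [X^c] in [odd_divisor_sum * psi], lifted from ['F_2] to [nat], with the
    truncations at [n = c + 1]. *)
Definition triangular_odd_reps c : nat :=
  (\sum_(0 <= i < c.+1) \sum_(0 <= k < c.+1.*2) \sum_(0 <= t < c.+1.*2)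
    (k.+1 * i.*2.+1 + 'C(t.+1, 2) == c))%N.

(** As [c] is not triangular, [X psi'] has no term in [X^c]; by divisibility the product has none
    either. *)
Lemma even_triangular_odd_reps c : (forall t, 'C(t, 2) <> c) -> ~~ odd (triangular_odd_reps c).
Proof.
move=> not_tri; rewrite -dvdn2 (dvdn_pcharf (pchar_Fp (isT : prime 2))).
have /dvdpP[q] := @Xn_dvd_odd_divisor_sum c.+1 isT.
move/(congr1 (fun p : {poly 'F_2} => p`_c)); rewrite /= coefMXn.
have -> : (c < c.+1.*2.+1)%N by lia.
rewrite coefD coefXM coef_deriv.
have -> : psi 'F_2 c.+1 = \sum_(t < c.+1.*2) 'X^'C(t.+1, 2) by [].
have psi_c : (\sum_(t < c.+1.*2) 'X^'C(t.+1, 2) : {poly 'F_2})`_c = 0.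
  rewrite coef_sum big1 // => t _; rewrite coefXn eq_sym.
  by case: eqP => // /not_tri.
have -> : (if c == 0 then 0 else (\sum_(t < c.+1.*2) 'X^'C(t.+1, 2) : {poly 'F_2})`_c.-1.+1 *+ c.-1.+1) = 0.
  by case: (c) psi_c => //= c' ->; rewrite mul0rn.
rewrite addr0 => <-.
rewrite /odd_divisor_sum mulr_suml coef_sum natr_sum big_mkord; apply/eqP/eq_bigr => i _.
rewrite mulr_suml coef_sum natr_sum big_mkord; apply/eq_bigr => k _.
rewrite mulr_sumr coef_sum natr_sum big_mkord; apply/eq_bigr => t _.
by rewrite -exprD coefXn eq_sym.
Qed.

End GaussModulo2.

(** * Solutions of [x^2 + 8 k b = M] with [b] odd *)

Lemma sum_count (T : Type) (s : seq T) (P : pred T) : \sum_(x <- s) (P x : nat) = count P s.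
Proof. by rewrite -sum1_count [in RHS]big_mkcond; apply: eq_bigr => x _; case: (P x). Qed.

Lemma triangular_odd_reps_count c :
  triangular_odd_reps c =
  count (fun '(i, k, t) => k.+1 * i.*2.+1 + 'C(t.+1, 2) == c)
    [seq (x, t) | x <- [seq (i, k) | i <- iota 0 c.+1, k <- iota 0 c.+1.*2], t <- iota 0 c.+1.*2].
Proof.
rewrite -sum_count !big_allpairs /triangular_odd_reps /index_iota !subn0.
by [].
Qed.

Lemma triangularE t : (t.*2.+1) * (t.*2.+1) = 8 * 'C(t.+1, 2) + 1.
Proof.
have : 'C(t.+1, 2).*2 = t.+1 * t by rewrite -mul2n -[2]/(2`!) mulnC bin_ffact ffactnS ffactn1.
lia.
Qed.

(** With [M = 8 c + 1] and [m = 2 t + 1] the equation becomes [k b + t (t + 1) / 2 = c], where [c]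
    is not triangular because [M] is not a square. *)
Lemma even_nsol8_odd M : M %% 8 = 1 -> nonsquare M ->
  ~~ odd (nsol 8 1 M (fun k b m a => (m == a) && odd b)).
Proof.
move=> M8 nsM; have [c eM] : exists c, M = 8 * c + 1 by exists (M %/ 8); lia.
have : ~~ odd (triangular_odd_reps c).
  apply: even_triangular_odd_reps => -[|t] ec.
    by apply: (nsM 1); rewrite eM -ec.
  by apply: (nsM t.*2.+1); rewrite triangularE ec.
congr (~~ odd _); rewrite triangular_odd_reps_count /nsol -lock.
apply: (count_bij (f := fun '(i, k, t) => (k.+1, i.*2.+1, t.*2.+1, t.*2.+1))
  (g := fun '(k, b, m, _) => (b./2, k.-1, m./2))); rewrite ?box_uniq //.
- by rewrite !allpairs_uniq ?iota_uniq // => -[? ?] [? ?] _ _ [-> ->].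
- move=> [[i k] t] _ /eqP e.
  have s : sol 8 1 M (k.+1, i.*2.+1, t.*2.+1, t.*2.+1).
    by rewrite /sol mul1n triangularE eM -e; apply/eqP; lia.
  split; [exact: sol_box s| |by congr (_, _, _); lia].
  by apply/andP; split; [exact: s|rewrite eqxx /= odd_double].
move=> [[[k b] m] a] _ /andP[/and5P[k0 b0 m0 a0 /eqP e] /andP[/eqP ema ob]].
have om : odd m by have := congr1 odd e; rewrite eM -ema oddD !oddM; lia.
have [t et] : exists t, m = t.*2.+1 by exists m./2; lia.
have [i eb] : exists i, b = i.*2.+1 by exists b./2; lia.
case: k k0 e => // k _ e; rewrite -ema et eb.
have -> : (i.*2.+1)./2 = i by lia.
have -> : (t.*2.+1)./2 = t by lia.
have e' : k.+1 * i.*2.+1 + 'C(t.+1, 2) = c.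
  by move: e; rewrite mul1n -ema et triangularE eb eM; lia.
split; [|by rewrite e' eqxx|by []].
have le_i := leq_pmull i.*2.+1 (ltn0Sn k).
have le_k := leq_pmulr k.+1 (ltn0Sn i.*2).
have ic : i < c.+1 by lia.
have kc : k < c.+1.*2 by lia.
have tc : t < c.+1.*2.
  have le_t : t <= t * t by case: (t) => // t'; rewrite leq_pmulr.
  by have := triangularE t; lia.
by rewrite !mem_allpairs_pair !mem_iota ic kc tc.
Qed.

(** Since [k] is even, the coefficient 2 may become 8, and 16 may become 4; between 8 and 16 the
    difference is even, and Zagier's involution treats 4. *)
Lemma odd_nsquares_mod8_1 M : M %% 8 = 1 -> nonsquare M -> odd (nsquares 2 M) = odd (halfdiv M).
Proof.
move=> M8 nsM; rewrite (nsquares_even (u := 2)) //; last exact: mod8_even_k.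
rewrite odd_nsquares8_split (negPf (even_nsol8_odd _ _)) //= -(nsquares_even (u := 4)) //; last first.
  exact: mod8_even_k.
by rewrite odd_zagier_halfdiv //; lia.
Qed.

(** * Overpartitions modulo 4 *)

Definition wf_parts (p : seq (nat * bool)) : bool :=
  [&& all (leq 1) (oparts p), pairwise geq (oparts p) & only_first_overlined p].

Lemma geq_trans : transitive geq.
Proof. by move=> y x z /= xy yz; apply: leq_trans yz xy. Qed.

Lemma is_overpartitionE n p : is_overpartition n p = wf_parts p && (sumn (oparts p) == n).
Proof.
rewrite /is_overpartition /wf_parts (sorted_pairwise geq_trans).
by rewrite -!andbA; do 2!congr (_ && _); rewrite andbC.
Qed.

Lemma only_first_overlined_rcons p v f :
  only_first_overlined (rcons p (v, f)) =
  only_first_overlined p && (f ==> (v \notin oparts p)).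
Proof.
rewrite /only_first_overlined size_rcons -addn1 iotaD all_cat /= add0n andbT.
have Eo : oparts (rcons p (v, f)) = rcons (oparts p) v by rewrite /oparts /unzip1 map_rcons.
have Ef : unzip2 (rcons p (v, f)) = rcons (unzip2 p) f by rewrite /unzip2 map_rcons.
have so : size (oparts p) = size p by rewrite size_map.
have sf : size (unzip2 p) = size p by rewrite size_map.
rewrite Eo Ef !nth_rcons so sf ltnn eqxx -!cats1 take_cat so ltnn subnn take0 cats0.
congr (_ && _); apply: eq_in_all => i; rewrite mem_iota => /andP[_ ip].
by rewrite !nth_cat so sf ip take_cat so ip.
Qed.

Lemma wf_parts_rcons p v f :
  wf_parts (rcons p (v, f)) =
  [&& wf_parts p, 0 < v, all (leq v) (oparts p) & f ==> (v \notin oparts p)].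
Proof.
rewrite /wf_parts only_first_overlined_rcons.
have -> : oparts (rcons p (v, f)) = rcons (oparts p) v by rewrite /oparts /unzip1 map_rcons.
rewrite all_rcons pairwise_rcons.
by case: (0 < v); case: (all _ _); case: (all _ _); case: (pairwise _ _); rewrite /= ?andbF.
Qed.

(** A pair [(k, b)] codes [b + 1] copies of [k], so that runs are nonempty; only the first copy may
    be overlined. *)
Definition run (k b : nat) (f : bool) : seq (nat * bool) := (k, f) :: nseq b (k, false).

Lemma runS k b f : run k b.+1 f = rcons (run k b f) (k, false).
Proof. by rewrite /run rcons_cons; congr (_ :: _); elim: b => //= b ->. Qed.

Lemma oparts_run p k b f : oparts (p ++ run k b f) = oparts p ++ nseq b.+1 k.
Proof. by rewrite /oparts /unzip1 map_cat /= map_nseq. Qed.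

Lemma wf_parts_run p k b f : all (ltn k) (oparts p) ->
  wf_parts (p ++ run k b f) = wf_parts p && (0 < k).
Proof.
move=> lt_k; have ge_k : all (leq k) (oparts p) by apply: sub_all lt_k => x /ltnW.
have kNp : k \notin oparts p by apply/negP => /(allP lt_k) /=; rewrite ltnn.
elim: b => [|b IHb]; first by rewrite /run cats1 wf_parts_rcons ge_k kNp implybT !andbT.
rewrite runS -rcons_cat wf_parts_rcons IHb oparts_run all_cat ge_k all_nseq leqnn orbT !andbT.
by rewrite -andbA andbb.
Qed.

Lemma wf_parts_decomp p : wf_parts p -> p != [::] ->
  exists q k b f, p = q ++ run k b f /\ all (ltn k) (oparts q).
Proof.
elim/last_ind: p => // p [v f] IHp; rewrite wf_parts_rcons => /and4P[wfp v0 ge_v fv] _.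
have [p0|/(IHp wfp)[q [k [b [g [ep lt_k]]]]]] := eqVneq p [::].
  by exists [::], v, 0, f; rewrite p0.
have vk : v <= k.
  by apply: (allP ge_v); rewrite ep oparts_run mem_cat mem_nseq eqxx orbT.
have [evk|vNk] := eqVneq v k.
  exists q, k, b.+1, g; split => //.
  case: f fv => /= fv.
    by rewrite ep oparts_run mem_cat mem_nseq evk eqxx orbT in fv.
  by rewrite runS evk -rcons_cat -ep.
exists p, v, 0, f; rewrite cats1; split => //.
apply/allP => x; rewrite ep oparts_run mem_cat mem_nseq => /orP[xq|/andP[_ /eqP->]] /=.
  by have /= := allP lt_k _ xq; lia.
by lia.
Qed.

Lemma last_run p k b f : smallest_part (p ++ run k b f) = k.
Proof.
rewrite /smallest_part oparts_run last_cat /=.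
by elim: b => //= b.
Qed.

Lemma num_smallest_run p k b f : all (ltn k) (oparts p) ->
  num_smallest_part (p ++ run k b f) = b.+1.
Proof.
move=> lt_k; rewrite /num_smallest_part last_run oparts_run count_cat count_nseq /= eqxx mul1n.
suff /count_memPn-> : k \notin oparts p by [].
by apply/negP => /(allP lt_k) /=; rewrite ltnn.
Qed.

Lemma run_inj p k b f p' k' b' f' :
    all (ltn k) (oparts p) -> all (ltn k') (oparts p') ->
    p ++ run k b f = p' ++ run k' b' f' ->
  [/\ p = p', k = k', b = b' & f = f'].
Proof.
move=> lt_k lt_k' e.
have ek : k = k' by rewrite -(last_run p k b f) e last_run.
have [eb] : b.+1 = b'.+1 by rewrite -(num_smallest_run b f lt_k) e num_smallest_run.
have es : size p = size p' by have := congr1 size e; rewrite !size_cat /= !size_nseq eb; lia.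
by move/eqP: e; rewrite -ek -eb eqseq_cat // => /andP[/eqP-> /eqP[->]].
Qed.

Definition kbs n := [seq (k, b) | k <- iota 0 n.+1, b <- iota 0 n].

Lemma kbs_uniq n : uniq (kbs n).
Proof. by rewrite allpairs_uniq ?iota_uniq // => -[? ?] [? ?] _ _ [-> ->]. Qed.

Lemma mem_kbs n k b : 0 < k -> k * b.+1 <= n -> (k, b) \in kbs n.
Proof.
move=> k0 le; rewrite mem_allpairs_pair !mem_iota /= !add0n ltnS.
have := leq_pmulr k (ltn0Sn b); have := leq_pmull b.+1 k0; lia.
Qed.

Definition runs s r :=
  [seq (u, f) | u <- [seq u <- kbs r | (s < u.1) && (u.1 * u.2.+1 <= r)], f <- [:: true; false]].

Lemma mem_runs s r k b f : ((k, b, f) \in runs s r) = (s < k) && (k * b.+1 <= r).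
Proof.
rewrite mem_allpairs_pair mem_filter /=; case: (ltnP s k) => //= sk.
case: leqP => //= le; rewrite mem_kbs ?(leq_ltn_trans _ sk) //.
by case: f.
Qed.

Lemma runs_uniq s r : uniq (runs s r).
Proof. by rewrite allpairs_uniq ?filter_uniq ?kbs_uniq // => -[? ?] [? ?] _ _ [-> ->]. Qed.

(* [t] is fuel: it is enough that [r <= t]. *)
Fixpoint overparts (t s r : nat) : seq (seq (nat * bool)) :=
  if r == 0 then [:: [::]] else
  if t is t'.+1 then
    [seq p ++ run x.1.1 x.1.2 x.2
       | x <- runs s r, p <- overparts t' x.1.1 (r - x.1.1 * x.1.2.+1)]
  else [::].

Lemma sumn_run p k b f : sumn (oparts (p ++ run k b f)) = sumn (oparts p) + k * b.+1.
Proof. by rewrite oparts_run sumn_cat sumn_nseq. Qed.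

(** [wf_parts_decomp] inverts one step of the recursion: it splits off the run of smallest parts and
    leaves larger parts with a smaller sum. *)
Lemma mem_overparts t s r p : r <= t ->
  (p \in overparts t s r) = [&& wf_parts p, all (ltn s) (oparts p) & sumn (oparts p) == r].
Proof.
elim: t s r p => [|t IHt] s r p /=.
  rewrite leqn0 => /eqP->; rewrite /= inE.
  apply/eqP/and3P => [->|[/and3P[pos _ _] _]] //.
  by case: p pos => //= x p /andP[x0 _]; rewrite addn_eq0; lia.
move=> rt; have [->|r0] := eqVneq r 0.
  rewrite inE; apply/eqP/and3P => [->|[/and3P[pos _ _] _]] //.
  by case: p pos => //= x p /andP[x0 _]; rewrite addn_eq0; lia.
apply/allpairsPdep/and3P => [[[[k b] f] [q [+ qin ->]]]|[wfp gt_s /eqP ep]].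
  rewrite mem_runs => /andP[sk le].
  move: qin; rewrite IHt /=; last by nia.
  case/and3P => wfq lt_k /eqP eq.
  have k0 : 0 < k by apply: leq_ltn_trans sk.
  split; first by rewrite wf_parts_run // wfq k0.
    rewrite oparts_run all_cat all_nseq /= sk andbT.
    by apply: sub_all lt_k => x /=; apply: ltn_trans.
  by rewrite sumn_run eq subnK.
have pn : p != [::] by case: (p) ep r0 => //= <-.
have [q [k [b [f [eqp lt_k]]]]] := wf_parts_decomp wfp pn.
move: wfp gt_s ep; rewrite eqp wf_parts_run // sumn_run oparts_run all_cat all_nseq /=.
move=> /andP[wfq k0] /andP[_ sk] ep.
exists (k, b, f), q; split => //=.
  by rewrite mem_runs sk -ep leq_addl.
rewrite IHt; first by rewrite wfq lt_k -ep addnK eqxx.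
by nia.
Qed.

Lemma overparts_uniq t s r : r <= t -> uniq (overparts t s r).
Proof.
elim: t s r => [|t IHt] s r /=; first by rewrite leqn0 => ->.
move=> rt; case: eqP => // r0.
apply: allpairs_uniq_dep => [|[[k b] f]|]; first exact: runs_uniq.
  by rewrite mem_runs => /andP[sk le]; apply: IHt => /=; nia.
have inP (z : {x : nat * nat * bool & seq (nat * bool)}) :
    z \in [seq existT (fun=> seq (nat * bool)) x p
             | x <- runs s r, p <- overparts t x.1.1 (r - x.1.1 * x.1.2.+1)] ->
    all (ltn (tag z).1.1) (oparts (tagged z)).
  case/allpairsPdep => -[[k b] f] [q [+ qin ->]] /=.
  rewrite mem_runs => /andP[sk le]; move: qin; rewrite mem_overparts /=; last by nia.
  by case/and3P.
move=> [[[k b] f] p] [[[k' b'] f'] p'] /inP /= lt_k /inP /= lt_k' e.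
by have [-> -> -> ->] := run_inj lt_k lt_k' e.
Qed.

Lemma odd_sum_count (T : Type) (s : seq T) (P : pred T) (F : T -> nat) :
  odd (\sum_(x <- s | P x) F x) = odd (count (fun x => P x && odd (F x)) s).
Proof.
elim: s => [|x s IHs]; first by rewrite big_nil.
by rewrite big_cons /=; case: (P x) => //=; rewrite !oddD IHs; case: (odd (F x)).
Qed.

Lemma double_mod4 x y : odd x = odd y -> x.*2 = y.*2 %[mod 4].
Proof. lia. Qed.

(** The factor 2 is the choice of overlining the first of the smallest parts. *)
Lemma size_overpartsS t s r : 0 < r ->
  size (overparts t.+1 s r) =
  (\sum_(u <- kbs r | (s < u.1) && (u.1 * u.2.+1 <= r))
     size (overparts t u.1 (r - u.1 * u.2.+1))).*2.
Proof.
move=> r0; rewrite /= gtn_eqF // size_allpairs_dep sumnE big_map big_allpairs_dep big_filter.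
rewrite -muln2 big_distrl /=; apply: eq_bigr => u _.
by rewrite !big_cons big_nil addn0 muln2 addnn.
Qed.

Lemma odd_size_overparts t s r : r <= t -> odd (size (overparts t s r)) = (r == 0).
Proof.
case: (posnP r) => [->|r0]; first by case: t.
by case: t => [|t] rt; [lia|rewrite size_overpartsS // odd_double; lia].
Qed.

(** After the factor 2 only parities matter, and [odd_size_overparts] keeps only the runs that leave
    nothing over. *)
Lemma size_overparts_mod4 t s r : r <= t ->
  size (overparts t s r) =
  (r == 0) + (count (fun u => (s < u.1) && (u.1 * u.2.+1 == r)) (kbs r)).*2 %[mod 4].
Proof.
case: (posnP r) => [->|r0]; first by case: t.
case: t => [|t] rt; first by lia.
rewrite size_overpartsS // add0n; apply: double_mod4.
rewrite odd_sum_count; congr odd; apply: eq_count => -[k b] /=.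
case: (ltnP s k) => //= sk; case: leqP => /= le; last by lia.
rewrite odd_size_overparts; first by lia.
by nia.
Qed.

Lemma odecode_inj n : injective (@odecode n).
Proof.
move=> c d e; apply: val_inj; apply: inj_map e => -[i f] [j g] [/val_inj-> ->] //.
Qed.

Lemma odecode_onto n p : is_overpartition n p -> exists c : ocode n, odecode c = p.
Proof.
rewrite is_overpartitionE => /andP[/and3P[pos _ _] /eqP ep].
have bound q : all (leq 1) (oparts q) ->
    size q <= sumn (oparts q) /\ {in q, forall x, x.1 <= sumn (oparts q)}.
  elim: q => //= x q IHq /andP[x0 /IHq[le1 le2]]; split; first by lia.
  by move=> y; rewrite inE => /predU1P[->|/le2]; lia.
have [le_n val_n] := bound p pos; rewrite ep in le_n val_n.
have sz : size [seq (inord x.1 : 'I_n.+1, x.2) | x <- p] <= n by rewrite size_map.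
exists (Bseq sz); rewrite /odecode /= -map_comp -[RHS]map_id.
apply/eq_in_map => -[v f] /val_n /= vn.
by rewrite inordK.
Qed.

Definition even_runs n :=
  [seq u <- kbs n | [&& 0 < u.1, ~~ odd u.1 & u.1 * u.2.+1 <= n]].

(** Overpartitions are grouped by their run of smallest parts: it contributes its length, and above
    it stands any overpartition of the remainder into larger parts. *)
Lemma spt2barE n : 0 < n ->
  spt2bar n = \sum_(u <- even_runs n) u.2.+1 * size (overparts n u.1 (n - u.1 * u.2.+1)).
Proof.
move=> n0; rewrite /spt2bar.
set good := fun p => is_overpartition n p && smallest_even_not_overlined p.
set L := [seq p ++ run u.1 u.2 false | u <- even_runs n,
              p <- overparts n u.1 (n - u.1 * u.2.+1)].
have inL (u : nat * nat) (q : seq (nat * bool)) : u \in even_runs n ->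
    q \in overparts n u.1 (n - u.1 * u.2.+1) -> 
    [/\ wf_parts q, all (ltn u.1) (oparts q), sumn (oparts q) + u.1 * u.2.+1 = n,
        0 < u.1 & ~~ odd u.1].
  rewrite mem_filter mem_overparts ?leq_subr // => /andP[/and3P[k0 ok le] _].
  by case/and3P => wfq ltk /eqP->; rewrite subnK.
have uL : uniq L.
  apply: allpairs_uniq_dep => [|u _|]; first by rewrite filter_uniq ?kbs_uniq.
    by rewrite overparts_uniq ?leq_subr.
  move=> x y /allpairsPdep[u [p [us ps ->]]] /allpairsPdep[v [q [vs qs ->]]] /= e.
  have [_ ltu _ _ _] := inL _ _ us ps; have [_ ltv _ _ _] := inL _ _ vs qs.
  have [-> e1 e2 _] := run_inj ltu ltv e.
  by case: (u) (v) e1 e2 => [? ?] [? ?] /= -> ->.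
have perm_L : perm_eq [seq odecode c | c <- [seq c <- index_enum _ | good (@odecode n c)]] L.
  apply: uniq_perm => // [|p].
    by rewrite (map_inj_uniq (@odecode_inj n)) filter_uniq // index_enum_uniq.
  apply/mapP/allpairsPdep => [[c + ->]|[u [q [us qs ->]]]].
    rewrite mem_filter => /andP[/andP[ov sm] _]; move: ov sm.
    move: (odecode c) => {c} {}p; rewrite is_overpartitionE => /andP[wfp /eqP ep] /andP[ev nov].
    have pn : p != [::] by case: (p) ep n0 => //= <-.
    have [q [k [b [f [eqp ltk]]]]] := wf_parts_decomp wfp pn.
    rewrite eqp last_run in ev nov.
    move: wfp ep; rewrite eqp wf_parts_run // sumn_run => /andP[wfq k0] eqn.
    exists (k, b), q; split => /=.
    - by rewrite mem_filter /= k0 ev mem_kbs // -eqn leq_addl.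
    - by rewrite mem_overparts ?leq_subr // wfq ltk -eqn addnK /=.
    by case: f eqp nov => // _ /negP[]; rewrite mem_cat inE eqxx orbT.
  have [wfq ltk eqn k0 ev] := inL _ _ us qs.
  have ov : is_overpartition n (q ++ run u.1 u.2 false).
    by rewrite is_overpartitionE wf_parts_run // wfq k0 sumn_run eqn /=.
  have [c ec] := odecode_onto ov; exists c => //.
  rewrite mem_filter /good ec ov mem_index_enum andbT /smallest_even_not_overlined last_run ev /=.
  rewrite mem_cat inE mem_nseq !xpair_eqE /= !andbF !orbF.
  by apply/negP => kq; have /(allP ltk) := map_f fst kq; rewrite /= ltnn.
transitivity (\sum_(p <- L) num_smallest_part p).
  by rewrite -(perm_big _ perm_L) big_map big_filter.
rewrite big_allpairs_dep big_seq [RHS]big_seq; apply: eq_bigr => u us.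
rewrite (eq_big_seq (fun=> u.2.+1)) => [|q qs].
  by rewrite big_const_seq count_predT iter_addn_0.
by have [_ ltk _ _ _] := inL _ _ us qs; rewrite num_smallest_run.
Qed.

Lemma eq_sum_mod m (T : eqType) (s : seq T) (F G : T -> nat) :
  {in s, forall x, F x = G x %[mod m]} -> \sum_(x <- s) F x = \sum_(x <- s) G x %[mod m].
Proof.
by move=> FG; rewrite -modn_summ -[in RHS]modn_summ; congr (_ %% _); apply: eq_big_seq.
Qed.

Definition sigma N := \sum_(d <- divisors N) d.

(** For a run filling [2 N] with an even part, the multiplicity ranges over the divisors of [N]. *)
Lemma sum_even_runs_exact N : 0 < N ->
  \sum_(u <- even_runs N.*2) u.2.+1 * (N.*2 - u.1 * u.2.+1 == 0) = sigma N.
Proof.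
move=> N0; have n0 : 0 < N.*2 by rewrite double_gt0.
pose ev := [seq u <- even_runs N.*2 | u.1 * u.2.+1 == N.*2].
have mem_ev u : (u \in ev) = [&& 0 < u.1, ~~ odd u.1 & u.1 * u.2.+1 == N.*2].
  rewrite !mem_filter; case: u => k b /=; rewrite andbC.
  case: eqP => [e|_]; last by rewrite !andbF.
  by rewrite -e leqnn !andbT; case: (posnP k) => //= k0; rewrite mem_kbs // ?andbT // -e leqnn.
transitivity (\sum_(d <- [seq u.2.+1 | u <- ev]) d).
  rewrite big_map /ev [RHS]big_filter [RHS]big_mkcond [LHS]big_seq [RHS]big_seq.
  apply: eq_bigr => u; rewrite mem_filter => /andP[/and3P[_ _ le] _].
  by rewrite subn_eq0 eqn_leq le /=; case: leqP; rewrite ?muln1 ?muln0.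
rewrite /sigma; apply: perm_big; apply: uniq_perm; rewrite ?divisors_uniq //.
  rewrite map_inj_in_uniq; first by rewrite !filter_uniq ?kbs_uniq.
  move=> [k b] [k' b']; rewrite !mem_ev /= => /and3P[_ _ /eqP e] /and3P[_ _ /eqP e'] [eb].
  by congr (_, _) => //; apply/eqP; rewrite -(eqn_pmul2r (ltn0Sn b)) e eb e'.
move=> d; rewrite -dvdn_divisors //; apply/mapP/dvdnP => [[[k b] + ->]|[c eN]] /=.
  rewrite mem_ev /= => /and3P[k0 ek /eqP e]; exists k./2.
  have ek' : k = k./2.*2 by lia.
  by rewrite ek' -doubleMl in e; apply: double_inj; rewrite -e.
have d0 : 0 < d by case: d eN => // eN; rewrite eN muln0 in N0.
have c0 : 0 < c by case: c eN => // eN; rewrite eN in N0.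
exists (c.*2, d.-1); rewrite ?prednK // mem_ev /= prednK // eN odd_double double_gt0 c0 /=.
by rewrite doubleMl.
Qed.

(** Only odd multiplicities [u.2.+1] matter. With [u] as [a] copies of [2 m] and [v] as [b] copies
    of [k], the pairs are the solutions counted by [cross]. *)
Lemma odd_sum_even_runs N : 0 < N ->
  odd (\sum_(u <- even_runs N.*2) u.2.+1 *
     count (fun v => (u.1 < v.1) && (v.1 * v.2.+1 == N.*2 - u.1 * u.2.+1))
           (kbs (N.*2 - u.1 * u.2.+1))) = odd (cross N).
Proof.
move=> N0.
pose L := [seq (u, v) | u <- [seq u <- even_runs N.*2 | ~~ odd u.2],
  v <- [seq v <- kbs (N.*2 - u.1 * u.2.+1)
          | (u.1 < v.1) && (v.1 * v.2.+1 == N.*2 - u.1 * u.2.+1)]].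
transitivity (odd (size L)).
  rewrite size_allpairs_dep sumnE big_map big_filter [in RHS]big_mkcond /=.
  rewrite !(big_morph odd oddD (erefl _)); apply: eq_bigr => u _.
  by rewrite oddM /= size_filter; case: odd.
congr odd; rewrite -(count_predT L) /cross /nsol -lock.
have mem_L m a k b : ((m, a), (k, b)) \in L =
    [&& 0 < m, ~~ odd m, ~~ odd a, m < k & m * a.+1 + k * b.+1 == N.*2].
  apply/allpairsPdep/idP => [[[m' a'] [[k' b'] [+ + [-> -> -> ->]]]]|].
    rewrite !mem_filter /= => /and3P[oa /and3P[m0 om le] _] /andP[/andP[mk /eqP->] _].
    by rewrite m0 om oa mk subnKC /=.
  case/and5P => m0 om oa mk /eqP e.
  exists (m, a), (k, b); split => //; rewrite !mem_filter /=.
    by rewrite oa m0 om mem_kbs // -?e leq_addr.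
  have -> : N.*2 - m * a.+1 = k * b.+1 by rewrite -e addKn.
  by rewrite mk eqxx mem_kbs ?(leq_ltn_trans _ mk).
apply: (count_bij
  (f := fun '((m, a), (k, b)) => (k, b.+1, m./2, a.+1))
  (g := fun '(k, b, m, a) => ((m.*2, a.-1), (k, b.-1)))); rewrite ?box_uniq //.
- apply: allpairs_uniq_dep => [|u _|]; rewrite ?filter_uniq ?kbs_uniq //.
  move=> x y /allpairsPdep[u [p [us ps ->]]] /allpairsPdep[v [q [vs qs ->]]] /= [-> ->] //.
- move=> [[m a] [k b]]; rewrite mem_L => /and5P[m0 om oa mk /eqP e] _.
  have em : m = m./2.*2 by lia.
  set h := m./2 in em *; rewrite em in m0 om mk e *.
  have s : sol 1 2 N.*2 (k, b.+1, h, a.+1) by apply/and5P; split; lia.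
  by split; [exact: sol_box s|apply/andP; split; [exact: s|rewrite /= oa mk]|].
move=> [[[k b] m] a] _ /andP[/and5P[k0 b0 m0 a0 /eqP e] /andP[oa mk]].
case: a a0 oa e => // a _ oa e; case: b b0 e => // b _ e.
split; [|by []|by rewrite doubleK].
rewrite mem_L /= double_gt0 m0 odd_double mk; move: oa => /= -> /=.
by apply/eqP; lia.
Qed.

Lemma spt2bar_mod4 N : 0 < N -> spt2bar N.*2 = sigma N + (cross N).*2 %[mod 4].
Proof.
move=> N0; rewrite spt2barE ?double_gt0 //.
rewrite -(sum_even_runs_exact N0) -modnDmr -(double_mod4 (odd_sum_even_runs N0)) modnDmr.
rewrite -[(\sum_(_ <- _) _).*2]muln2 big_distrl -big_split /=; apply: eq_sum_mod => u _.
by rewrite -mulnA muln2 -mulnDr -modnMmr size_overparts_mod4 ?leq_subr // modnMmr.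
Qed.

(** * Sums of divisors modulo 4 *)

Lemma sigma_halfdiv M : nonsquare M ->
  sigma M = \sum_(d <- divisors M | d * d < M) (d + M %/ d).
Proof.
move=> nsM; have M0 := nonsquare_gt0 nsM.
rewrite /sigma (bigID (fun d => d * d < M)) big_split /=; congr (_ + _).
rewrite -big_filter -[RHS]big_filter.
rewrite -(big_map (divn M) xpredT id); apply: perm_big.
have divM d (dM : d \in divisors M) := divisors_invol M0 dM.
apply: uniq_perm; rewrite ?filter_uniq ?divisors_uniq //.
  rewrite map_inj_in_uniq ?filter_uniq ?divisors_uniq // => d e.
  by rewrite !mem_filter => /andP[_ /divM[_ dK]] /andP[_ /divM[_ eK]] de; rewrite -dK de eK.
have flip d : d \in divisors M -> (M %/ d) * (M %/ d) < M = ~~ (d * d < M).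
  rewrite -dvdn_divisors // => /dvdnP[c eM].
  have d0 : 0 < d by case: d eM => // eM; rewrite eM muln0 in M0.
  have c0 : 0 < c by case: c eM => // eM; rewrite eM in M0.
  have := nsM c; rewrite {2 3 4 5}eM mulnK // ltn_pmul2l // ltn_pmul2r // => ncd.
  have : c <> d by move=> ecd; apply: ncd; rewrite [in RHS]eM ecd.
  lia.
move=> e; rewrite mem_filter; apply/andP/mapP => [[lt eM]|[d]].
  by have [eM' eK] := divM e eM; exists (M %/ e); rewrite ?mem_filter ?flip ?lt // eK.
rewrite mem_filter => /andP[lt dM] ->; have [dM' _] := divM d dM.
by rewrite flip // lt dM'.
Qed.

(** Each pair [d + M / d] is 2 modulo 4 if [M = 1 mod 4], and 0 if [M = 3 mod 4]. *)
Lemma sigma_mod4 M : odd M -> nonsquare M ->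
  sigma M = if M %% 4 == 1 then (halfdiv M).*2 else 0 %[mod 4].
Proof.
move=> oM nsM; have M0 := nonsquare_gt0 nsM; rewrite sigma_halfdiv //.
have sum_mod4 d : d \in divisors M -> (d + M %/ d) %% 4 = if M %% 4 == 1 then 2 else 0.
  rewrite -dvdn_divisors // => /divnK eM.
  have [e4 c4] := mulmod4 (M %/ d) d; have [_ d4] := mulmod4 d d; rewrite eM in e4.
  have : M %% 4 = 1 \/ M %% 4 = 3 by lia.
  by case: c4 d4 e4 => c4 [] d4; rewrite c4 d4 /=; case: eqP; lia.
rewrite -big_filter; set s := [seq _ <- _ | _].
have -> : (if M %% 4 == 1 then (halfdiv M).*2 else 0) = \sum_(d <- s) if M %% 4 == 1 then 2 else 0.
  rewrite big_const_seq count_predT iter_addn_0 size_filter /halfdiv.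
  by case: ifP => _; rewrite ?mul2n ?mul0n.
apply: eq_sum_mod => d; rewrite mem_filter => /andP[_ /sum_mod4 ->].
by case: ifP.
Qed.

Lemma sigma_double_odd N : 0 < N -> sigma N.*2 = \sum_(d <- divisors N | odd d) d + (sigma N).*2.
Proof.
move=> N0; have n0 : 0 < N.*2 by rewrite double_gt0.
rewrite /sigma (bigID odd) /=; congr (_ + _).
  rewrite -big_filter -[RHS]big_filter; apply: perm_big; apply: uniq_perm; rewrite ?filter_uniq ?divisors_uniq //.
  move=> d; rewrite !mem_filter -!dvdn_divisors //; case od: (odd d) => //=.
  by rewrite -mul2n Gauss_dvdr // coprimen2.
rewrite -[(\sum_(_ <- _) _).*2]mul2n big_distrr /= -big_filter -(big_map (muln 2) xpredT id); apply: perm_big.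
apply: uniq_perm; rewrite ?filter_uniq ?divisors_uniq //.
  by rewrite map_inj_uniq ?divisors_uniq // => x y; lia.
move=> d; rewrite mem_filter -dvdn_divisors //; apply/andP/mapP => [[ed dN]|[e + ->]].
  have ed' : d = d./2.*2 by lia.
  exists d./2; last by rewrite mul2n.
  by rewrite -dvdn_divisors // -(dvdn_pmul2l (isT : 0 < 2)) !mul2n -ed'.
by rewrite -dvdn_divisors // => eN; rewrite oddM -mul2n dvdn_pmul2l.
Qed.

(** A doubling gives [sigma M] from the odd divisors plus twice the previous sum, which stays even
    because [sigma M] is even. *)
Lemma sigma_pow2 j M : odd M -> nonsquare M -> sigma (2 ^ j * M) = sigma M %[mod 4].
Proof.
move=> oM nsM; have M0 := nonsquare_gt0 nsM.
have even_sigma : ~~ odd (sigma M).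
  by have := sigma_mod4 oM nsM; case: ifP => _; lia.
have odd_part i : \sum_(d <- divisors (2 ^ i * M) | odd d) d = sigma M.
  rewrite /sigma -big_filter; apply: perm_big.
  apply: uniq_perm; rewrite ?filter_uniq ?divisors_uniq // => d.
  rewrite mem_filter -!dvdn_divisors ?muln_gt0 ?expn_gt0 //.
  apply/andP/idP => [[od]|dM]; first exact: odd_dvdn_pow2M.
  by rewrite (dvdn_odd dM oM) dvdn_mull.
elim: j => [|j IHj]; first by rewrite mul1n.
rewrite expnS -mulnA mul2n sigma_double_odd ?muln_gt0 ?expn_gt0 // odd_part.
by lia.
Qed.

(** The divisors of [3 K] are [d] and [3 d] for [d] dividing [K], without overlap. *)
Lemma sigma_3K K : K %% 3 != 0 -> sigma (3 * K) = 4 * sigma K.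
Proof.
move=> K3; have K0 : 0 < K by lia.
have K30 : 0 < 3 * K by rewrite muln_gt0.
rewrite -[4]/(1 + 3) mulnDl mul1n /sigma big_distrr /=.
rewrite -(big_map (muln 3) xpredT id) -big_cat; apply: perm_big.
apply: uniq_perm; rewrite ?divisors_uniq //.
  rewrite cat_uniq divisors_uniq map_inj_uniq ?divisors_uniq ?andbT /=; last by move=> x y; lia.
  apply/hasPn => _ /mapP[d + ->]; rewrite -!dvdn_divisors // => dK.
  apply/negP => dK3; move: K3; rewrite -/(dvdn 3 K) (dvdn_trans _ dK3) // dvdn_mulr //.
move=> d; rewrite mem_cat -!dvdn_divisors //; apply/idP/orP => [d3K|[dK|/mapP[e + ->]]].
- have [/dvdnP[e ed]|n3d] := boolP (3 %| d); last first.
    by left; rewrite Gauss_dvdr // in d3K; rewrite coprime_sym prime_coprime.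
  right; apply/mapP; exists e; last by rewrite mulnC.
  by rewrite -dvdn_divisors // -(dvdn_pmul2l (isT : 0 < 3)) mulnC -ed.
- by rewrite dvdn_mull.
by rewrite -dvdn_divisors // dvdn_pmul2l.
Qed.

(** * The congruences by class of [M] *)

Lemma spt2bar_pow2_mod4 j M : odd M -> nonsquare M ->
  spt2bar (2 ^ j * M).*2 = sigma M + (nsquares 2 M).*2 %[mod 4].
Proof.
move=> oM nsM; rewrite spt2bar_mod4; last by rewrite muln_gt0 expn_gt0 (nonsquare_gt0 nsM).
by rewrite -modnDm sigma_pow2 // (double_mod4 (odd_cross_pow2 j oM nsM)) modnDm.
Qed.

Lemma spt2bar_mod8_7 j M : M %% 8 = 7 -> spt2bar (2 ^ j * M).*2 = 0 %[mod 4].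
Proof.
move=> M8; have nsM : nonsquare M.
  move=> x ex; have [ox|ex2] := boolP (odd x).
    by have [t et] := odd_sqr_mod8 ox; lia.
  by have := congr1 odd ex; rewrite oddM (negPf ex2); lia.
rewrite spt2bar_pow2_mod4 ?nsquares_mod8_7 ?addn0 ?sigma_mod4 //; try by lia.
by case: eqP; lia.
Qed.

(** Modulo 4, both [sigma M] and [2 F(M)] are [2 halfdiv M]. *)
Lemma spt2bar_mod8_1 j M : M %% 8 = 1 -> nonsquare M -> spt2bar (2 ^ j * M).*2 = 0 %[mod 4].
Proof.
move=> M8 nsM; have oM : odd M by lia.
rewrite spt2bar_pow2_mod4 // -modnDm sigma_mod4 //.
rewrite (double_mod4 (odd_nsquares_mod8_1 M8 nsM)) modnDm.
have -> : M %% 4 == 1 by lia.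
by lia.
Qed.

Lemma spt2bar_3K j K : odd K -> K %% 3 != 0 -> nonsquare K ->
  spt2bar (2 ^ j * (3 * K)).*2 = 0 %[mod 4].
Proof.
move=> oK K3 nsK; rewrite spt2bar_pow2_mod4 ?oddM ?oK //; last first.
  move=> x ex; have /dvdnP[y ey] : 3 %| x.
    have : 3 %| x * x by rewrite ex dvdn_mulr.
    by rewrite Euclid_dvdM // orbb.
  have : 3 * (y * y) = K by rewrite ey in ex; lia.
  by lia.
rewrite sigma_3K //; have := even_nsquares_3K oK K3 nsK; lia.
Qed.

Lemma nonsquare_mod M m r : 0 < m -> M %% m = r ->
  all (fun i => (i * i) %% m != r) (iota 0 m) -> nonsquare M.
Proof.
move=> m0 eM /allP nr x ex.
have /nr : x %% m \in iota 0 m by rewrite mem_iota ltn_mod.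
by rewrite modnMml modnMmr ex eM eqxx.
Qed.

Theorem theorem1p2 (j n : nat) :
  [/\ spt2bar (2 ^ (j + 4) * n + 7 * 2 ^ (j + 1)) = 0 %[mod 4],
      spt2bar (2 ^ (j + 2) * (9 * n) + 15 * 2 ^ (j + 1)) = 0 %[mod 4]
    & spt2bar (2 ^ (j + 4) * (3 * n) + 17 * 2 ^ (j + 1)) = 0 %[mod 4]] /\
  [/\ spt2bar (2 ^ (j + 3) * (9 * n) + 21 * 2 ^ (j + 1)) = 0 %[mod 4],
      spt2bar (2 ^ (j + 4) * (5 * n) + 17 * 2 ^ (j + 1)) = 0 %[mod 4]
    & spt2bar (2 ^ (j + 4) * (5 * n) + 33 * 2 ^ (j + 1)) = 0 %[mod 4]].
Proof.
(* Each argument is [2^(j+1) M]. Squares are excluded by residues: [6n+5] and [24n+17] are 2 modulo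
   3, [12n+7] is 3 modulo 4, and [40n+17], [40n+33] are 2 and 3 modulo 5. *)
rewrite !expnD; move: (2 ^ j) (fun M => @spt2bar_mod8_7 j M)
  (fun M => @spt2bar_mod8_1 j M) (fun K => @spt2bar_3K j K) => p H7 H1 H3.
split; split.
- have -> : p * 2 ^ 4 * n + 7 * (p * 2 ^ 1) = (p * (8 * n + 7)).*2 by lia.
  by apply: H7; lia.
- have -> : p * 2 ^ 2 * (9 * n) + 15 * (p * 2 ^ 1) = (p * (3 * (6 * n + 5))).*2 by lia.
  by apply: H3; [lia|lia|apply: (@nonsquare_mod _ 3 2) => //; lia].
- have -> : p * 2 ^ 4 * (3 * n) + 17 * (p * 2 ^ 1) = (p * (24 * n + 17)).*2 by lia.
  by apply: H1; [lia|apply: (@nonsquare_mod _ 3 2) => //; lia].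
- have -> : p * 2 ^ 3 * (9 * n) + 21 * (p * 2 ^ 1) = (p * (3 * (12 * n + 7))).*2 by lia.
  by apply: H3; [lia|lia|apply: (@nonsquare_mod _ 4 3) => //; lia].
- have -> : p * 2 ^ 4 * (5 * n) + 17 * (p * 2 ^ 1) = (p * (40 * n + 17)).*2 by lia.
  by apply: H1; [lia|apply: (@nonsquare_mod _ 5 2) => //; lia].
have -> : p * 2 ^ 4 * (5 * n) + 33 * (p * 2 ^ 1) = (p * (40 * n + 33)).*2 by lia.
by apply: H1; [lia|apply: (@nonsquare_mod _ 5 3) => //; lia].
Qed.
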